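(* Let $n\ge 2$, let $W$ be a Weyl group of type $D_n$, and let $c\in ce'(W)$. Let $\phi'_c: Sym'_n(c)\to\mathbf{B}_c$ be the bijection $\Lambda\mapsto[E_\Lambda]$, and let $Sym'_n(c)^{as}=\{\Lambda\in Sym'_n(c) : |S(\Lambda)|=p(c)-1\}$. Then $\phi'_c$ restricts to a bijection $Sym'_n(c)^{as}\to Con_c$. Hence $c^{as}=\{E_\Lambda : \Lambda\in Sym'_n(c)^{as}\}$, where $c^{as}=\{E\in c : [E]\in Con_c\}$.
   Context: **Symbols.** For $n\ge 2$, $Sym'_n$ is the set of sequences $\Lambda=(a_1,a_2,\dots,a_{2m})$ in $\mathbf{N}=\{0,1,2,\dots\}$ (any $m\ge 1$) such that $a_1<a_3<\cdots<a_{2m-1}$, $a_2<a_4<\cdots<a_{2m}$, $a_1+\cdots+a_{2m}=n+m^2-m$, $0$ does not appear twice in $\Lambda$, some number appears exactly once in $\Lambda$, and the largest number appearing exactly once is of the form $a_{2i}$ (is in an even position). Two elements of $Sym'_n$ are equivalent if they have the same entries up to a permutation. **$S(\Lambda)$ and $p(\Lambda)$.** For $\Lambda=(a_1,\dots,a_{2m})\in Sym'_n$ form the subsequence $a_{i_1},a_{i_2},\dots,a_{i_{2p}}$ ($i_1<i_2<\cdots<i_{2p}$) consisting of all entries $a_i$ that appear exactly once in $\Lambda$; here $p\ge 1$. Let $S(\Lambda)$ be the set of all $j\in[1,2p-1]$ such that $a_{i_j}>a_{i_{j+1}}$, and let $p(\Lambda)=p$. **Irreducible representations and families.** $W$ is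 the group of signed permutations of $n$ letters with an even number of sign changes, an index two subgroup of the group $W(B_n)$ of all signed permutations (for $n=2$, $W$ is of type $A_1\times A_1$). Representations are finite dimensional over $\mathbf{Q}$ and $\mathrm{Irr}(W)$ is the set of irreducible ones up to isomorphism. To $\Lambda\in Sym'_n$ attach the partitions $\xi$ with parts $a_{2i-1}-(i-1)$ and $\eta$ with parts $a_{2i}-(i-1)$ ($1\le i\le m$); then $|\xi|+|\eta|=n$ and $\xi\ne\eta$. Let $E_\Lambda$ be the restriction to $W$ of the irreducible representation of $W(B_n)$ indexed in the usual way by the bipartition $(\xi;\eta)$ (induced from $W(B_{|\xi|})\times W(B_{|\eta|})$ of $\xi\boxtimes(\eta\otimes\chi)$, where $\xi,\eta$ are inflated from symmetric groups, the one-row partition giving the trivial representation, and $\chi$ is the character equal to $1$ on permutations and $-1$ on a single sign change). Then $E_\Lambda$ is irreducible and $\Lambda\mapsto E_\Lambda$ is a bijection from $Sym'_n$ onto a subset $\mathrm{Irr}'(W)$ of $\mathrm{Irr}(W)$ which is a union of families; the set of these families is denoted $ce'(W)$. The families in $ce'(W)$ are the sets $c=\{E_\Lambda\}$ with $\Lambda$ running over an equivalence class in $Sym'_n$; this class is denoted $Sym'_n(c)$. The number $p(\Lambda)$ is the same for all $\Lambda\in Sym'_n(c)$ and is denoted $p(c)$. **New and constructible representations.** For $q\ge 0$ let $A_q$ be the set of sequences $(b_1,\dots,b_{2q+1})$ which are permutations of $0,1,\dots,2q$ with $b_1<b_3<\cdots<b_{2q+1}$ and $b_2<b_4<\cdots<b_{2q}$.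 View an element of $A_q$ as a splitting of $\{0,\dots,2q\}$ into a set $T$ of $q+1$ ''odd position'' elements and a set $B$ of $q$ ''even position'' elements. For $q\ge 1$, $i\in[0,2q-1]$ and a subset $Y\subset A_{q-1}$, let $I_i(Y)\subset A_q$ be the set of all splittings obtained as follows: take an element of $Y$, relabel $\{0,\dots,2q-2\}$ by the order preserving bijection onto $\{0,\dots,2q\}-\{i,i+1\}$, and then put one of $i,i+1$ into $T$ and the other into $B$ (both choices are taken, giving two elements of $A_q$ for each element of $Y$). Define collections $\mathcal{B}_q$ and $\mathcal{C}_q$ of subsets of $A_q$ by induction: $\mathcal{B}_0=\mathcal{C}_0=\{A_0\}$; for $q\ge 1$, $\mathcal{B}_q$ consists of the singleton $\{(0,1,2,\dots,2q)\}$ together with all $I_i(Y)$ with $i\in[0,2q-1]$, $Y\in\mathcal{B}_{q-1}$, and $\mathcal{C}_q$ consists of all $I_i(Y)$ with $i\in[0,2q-1]$, $Y\in\mathcal{C}_{q-1}$. For $p\ge 1$ let $A'_p$ be the set of sequences $(b_1,\dots,b_{2p})$ which are permutations of $0,1,\dots,2p-1$ with $b_1<b_3<\cdots<b_{2p-1}$, $b_2<b_4<\cdots<b_{2p}$ and $b_{2p}=2p-1$. There is a bijection $\iota: A_{p-1}\to A'_p$, $(b_1,\dots,b_{2p-1})\mapsto(b_1,\dots,b_{2p-1},2p-1)$. Let $c\in ce'(W)$ with $p(c)=p$, and let $z_0<z_1<\cdots<z_{2p-1}$ be the numbers appearing exactly once in the elements of $Sym'_n(c)$. For $\Lambda\in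 Sym'_n(c)$ let $\bar\Lambda=(b_1,\dots,b_{2p})\in A'_p$, where $b_1<b_3<\cdots$ are the $k$ such that $z_k$ is in an odd position of $\Lambda$ and $b_2<b_4<\cdots$ are the $k$ such that $z_k$ is in an even position; then $\Lambda\mapsto\bar\Lambda$ is a bijection $Sym'_n(c)\to A'_p$. The set $\mathbf{B}_c$ of new representations attached to $c$ consists of the representations $\bigoplus_{\Lambda\in Sym'_n(c),\,\bar\Lambda\in\iota(Y)}E_\Lambda$ for $Y\in\mathcal{B}_{p-1}$, and the set $Con_c\subset\mathbf{B}_c$ of constructible representations consists of those with $Y\in\mathcal{C}_{p-1}$ (these are exactly the representations of $W$ carried by the left cells contained in $c$). **The bijection $E\mapsto[E]$.** It is known (Lusztig, ''A new basis for the representation ring of a Weyl group'', 2019) that there is a unique bijection $c\to\mathbf{B}_c$, $E\mapsto[E]$, such that for every $E\in c$, $E$ appears with multiplicity $>0$ in $[E]$.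
   Formalization: S(Λ) is corrected: repeated entries are deleted from the odd and even rows separately and the rows re-interleaved before taking descents; with the printed S(Λ) the claim fails, e.g. n=5, class of (1,0,2,1,3,4), where Sym'_n(c)^as has one element but Con_c has two. *)

(* Defs.v *)
From HB Require Import structures.
From mathcomp Require Import all_boot all_order all_algebra all_fingroup.
From mathcomp Require Import all_solvable all_field all_character.
From mathcomp Require Import boolp classical_sets functions fsbigop.

Set Implicit Arguments.
Unset Strict Implicit.
Unset Printing Implicit Defensive.

Import GRing.Theory.

(* Sequences are indexed from 1 in the mathematics and from 0 here, so that
   a_1, a_3, ... are the entries of even index. *)
Definition oddpos (s : seq nat) : seq nat :=
  [seq nth 0 s i | i <- iota 0 (size s) & ~~ odd i].
Definition evenpos (s : seq nat) : seq nat :=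
  [seq nth 0 s i | i <- iota 0 (size s) & odd i].

(* The sequence with odd-position entries t and even-position entries b;
   meaningful when size t is size b or (size b).+1. *)
Definition interleave (t b : seq nat) : seq nat :=
  mkseq (fun i => nth 0 (if odd i then b else t) i./2) (size t + size b).

Definition once (L : seq nat) : pred nat := fun x => count_mem x L == 1.
Definition singles (L : seq nat) : seq nat := [seq x <- L | once L x].

Definition Sym' (n : nat) (L : seq nat) : Prop :=
  exists2 m, 1 <= m &
  [/\ size L = m.*2,
      sorted ltn (oddpos L) /\ sorted ltn (evenpos L),
      sumn L = n + m ^ 2 - m,
      count_mem 0 L <= 1
    & singles L <> [::] /\ \max_(x <- singles L) x \in evenpos L].

(* The entries of L appearing exactly once, each kept in its row (odd or even
   positions). For L in Sym' both rows have p(L) such entries, the repeated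
   entries occurring once in each row. Deleting the repeated entries from L
   itself would not preserve the rows: (1,0,2,1,3,4) would give (0,2,3,4),
   where 0 has moved to an odd position and the descent of (2,0,3,4) is lost.
   The two readings agree when the entries appearing once alternate between
   odd and even positions of L, in particular when no entry is repeated. *)
Definition reduced (L : seq nat) : seq nat :=
  interleave [seq x <- oddpos L | once L x] [seq x <- evenpos L | once L x].

Definition pnum (L : seq nat) : nat := (size (singles L))./2.

Definition Sset (L : seq nat) : seq nat :=
  [seq j <- iota 1 (pnum L).*2.-1
     | nth 0 (reduced L) j < nth 0 (reduced L) j.-1].

Definition Lbar (L : seq nat) : seq nat :=
  let z := sort leq (singles L) in
  let row r := [seq k <- iota 0 (size z) | nth 0 z k \in r] in
  interleave (row (oddpos L)) (row (evenpos L)).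

Section Collections.
Local Open Scope classical_set_scope.

Definition Aset (q : nat) : set (seq nat) :=
  [set b | [/\ perm_eq b (iota 0 q.*2.+1),
               sorted ltn (oddpos b) & sorted ltn (evenpos b)]].

Definition split_seq (T B : seq nat) : seq nat :=
  interleave (sort leq T) (sort leq B).

(* Relabels by the order preserving bijection onto the complement of
   {i, i + 1}, then puts i into T iff inT, and i + 1 into the other part. *)
Definition insert_pair (i : nat) (inT : bool) (b : seq nat) : seq nat :=
  let r k := if k < i then k else k.+2 in
  split_seq ((if inT then i else i.+1) :: map r (oddpos b))
            ((if inT then i.+1 else i) :: map r (evenpos b)).

Definition Iset (i : nat) (Y : set (seq nat)) : set (seq nat) :=
  insert_pair i true @` Y `|` insert_pair i false @` Y.

Fixpoint Bcoll (q : nat) : set (set (seq nat)) :=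
  if q is q'.+1 then
    [set [set iota 0 q.*2.+1]] `|`
    [set X | exists i Y, [/\ i < q.*2, Bcoll q' Y & X = Iset i Y]]
  else [set Aset 0].

Fixpoint Ccoll (q : nat) : set (set (seq nat)) :=
  if q is q'.+1 then
    [set X | exists i Y, [/\ i < q.*2, Ccoll q' Y & X = Iset i Y]]
  else [set Aset 0].

Definition iota_p (p : nat) (b : seq nat) : seq nat := rcons b p.*2.-1.

End Collections.

Section SignCharacter.
Local Open Scope group_scope.
Variables (gT : finGroupType) (G : {group gT}) (f : gT -> bool).
Hypothesis fM : {in G &, {morph f : x y / x * y >-> x (+) y}}.

Fact sign_subproof :
  is_class_fun <<G>> [ffun s => (-1) ^+ f s *+ (s \in G) : algC]%R.
Proof.
rewrite genGid; apply: intro_class_fun => [x y Gx Gy | x /negPf-> //].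
have f1 : f 1 = false by have := fM (group1 G) (group1 G); rewrite mulg1; case: (f 1).
have fV : f y^-1 = f y.
  have := fM (groupVr Gy) Gy; rewrite mulVg f1.
  by case: (f y); case: (f y^-1).
rewrite groupJ // Gx conjgE !fM ?groupM ?groupV // fV.
by case: (f y); case: (f x).
Qed.
Definition sign_char : 'CF(G) := Cfun 1 sign_subproof.

End SignCharacter.

(* The irreducible representation of the symmetric group of a set A of letters
   indexed by a partition lam of #|A|. Number the letters of A by the cells of
   the diagram of lam, row by row; R and C are the row and column stabilizers.
   The representation is the unique common irreducible constituent of Ind 1
   (from R) and Ind sgn (from C). The one-row partition gives R = Sym A, hence
   the trivial representation. The value is junk if sumn lam <> #|A|. *)
Section SymmetricGroup.
Local Open Scope group_scope.
Variables (T : finType) (A : {set T}).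

Definition stab (f : T -> nat) : {set {perm T}} :=
  [set s in perm.Sym A | [forall x, f (s x) == f x]].

Lemma stab_group_set f : group_set (stab f).
Proof.
apply/group_setP; split=> [|s t]; first rewrite inE group1.
  by apply/forallP=> x; rewrite perm1.
rewrite !inE => /andP[As /forallP fs] /andP[At /forallP ft].
rewrite perm_onM //=; apply/forallP=> x.
by rewrite permM (eqP (ft _)) (eqP (fs _)).
Qed.
Canonical stab_group f := Group (stab_group_set f).

Definition cell_row (lam : seq nat) (x : T) : nat :=
  reshape_index lam (index x (enum A)).
Definition cell_col (lam : seq nat) (x : T) : nat :=
  reshape_offset lam (index x (enum A)).

Lemma odd_permM_in (G : {group {perm T}}) :
  {in G &, {morph @odd_perm T : s t / s * t >-> s (+) t}}.
Proof. by move=> s t _ _; apply: odd_permM. Qed.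

Definition specht (lam : seq nat) : 'CF(perm.Sym A) :=
  let R := stab_group (cell_row lam) in
  let C := stab_group (cell_col lam) in
  let row_ind : 'CF(perm.Sym A) := ('Ind[perm.Sym A] (1 : 'CF(R)))%R in
  let col_ind : 'CF(perm.Sym A) :=
    ('Ind[perm.Sym A] (sign_char (@odd_permM_in C)))%R in
  ('chi_(odflt 0
    [pick i | (i \in irr_constt row_ind) && (i \in irr_constt col_ind)]))%R.

End SymmetricGroup.

(* Signed permutations of n letters act on 'I_n * bool, where (i, false) is the
   letter i and (i, true) is its negative. *)
Section SignedPermutations.
Local Open Scope group_scope.
Variable n : nat.
Implicit Types s t : {perm 'I_n * bool}.

Lemma neg_inj : injective (fun x : 'I_n * bool => (x.1, ~~ x.2)).
Proof. by case=> i a [j b] [-> /negb_inj ->]. Qed.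
Definition negp : {perm 'I_n * bool} := perm neg_inj.

Definition WB : {group {perm 'I_n * bool}} := 'C[negp]%G.

Definition sign_changes s : {set 'I_n} := [set i | (s (i, false)).2].

Lemma WBP s :
  reflect (forall i b, s (i, b) = ((s (i, false)).1, (s (i, false)).2 (+) b))
          (s \in WB).
Proof.
apply: (iffP idP) => [/cent1P/permP cs i b | cs].
  have := cs (i, false); rewrite !permM !permE /= => e.
  by case: b; rewrite ?addbT ?addbF // -?surjective_pairing.
apply/cent1P/permP=> -[i b]; rewrite !permM !permE /= (cs i b) (cs i (~~ b)) /=.
by rewrite addbN.
Qed.

Definition absp s : 'S_n :=
  odflt 1 [pick t : 'S_n | [forall i, t i == (s (i, false)).1]].

Lemma abspE s i : s \in WB -> absp s i = (s (i, false)).1.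
Proof.
move=> /WBP cs; rewrite /absp; case: pickP => [t /forallP/(_ i)/eqP // | no].
have inj : injective (fun i : 'I_n => (s (i, false)).1).
  move=> j k /= e; case E: ((s (j, false)).2 == (s (k, false)).2).
    suff /perm_inj[]: s (j, false) = s (k, false) by [].
    by rewrite [LHS]surjective_pairing [RHS]surjective_pairing e (eqP E).
  suff /perm_inj[]: s (j, false) = s (k, true) by [].
  rewrite [RHS]cs -e [LHS]surjective_pairing; congr pair.
  by move: E; case: (s (j, _)).2; case: (s (k, _)).2.
by have /forallP[] := negbT (no (perm inj)) => j; rewrite permE.
Qed.

Lemma abspM : {in WB &, {morph absp : s t / s * t}}.
Proof.
move=> s t Ws Wt; apply/permP=> i; rewrite permM !abspE ?groupM // permM.
by have /WBP ct := Wt; rewrite [s (i, false)]surjective_pairing [LHS]/= ct.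
Qed.
Canonical absp_morphism := Morphism abspM.

Lemma odd_sign_changesM :
  {in WB &, {morph (fun s => odd #|sign_changes s|) : s t / s * t >-> s (+) t}}.
Proof.
have E u : odd #|sign_changes u| = \big[addb/false]_i (u (i, false)).2.
  rewrite -sum1_card big_mkcond (big_morph odd oddD (erefl _)) /=.
  by apply: eq_bigr => i _; rewrite inE; case: ifP.
move=> s t Ws Wt; have /WBP ct := Wt; rewrite !E.
rewrite [in X in _ (+) X](reindex_inj (@perm_inj _ (absp s))) -big_split /=.
apply: eq_bigr => i _; rewrite permM abspE //.
by rewrite [s (i, false)]surjective_pairing [in LHS]ct /= addbC.
Qed.

Definition WD_set : {set {perm 'I_n * bool}} :=
  [set s in WB | ~~ odd #|sign_changes s|].

Lemma WD_group_set : group_set WD_set.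
Proof.
apply/group_setP; split=> [|s t].
  rewrite inE group1 /=; suff ->: sign_changes 1 = finset.set0 by rewrite cards0.
  by apply/setP=> i; rewrite !inE perm1.
rewrite 3![_ \in WD_set]inE => /andP[Ws /negPf es] /andP[Wt /negPf et].
by rewrite groupM //= odd_sign_changesM // es et.
Qed.
Definition WD : {group {perm 'I_n * bool}} := Group WD_group_set.

Definition chiB : 'CF(WB) := sign_char odd_sign_changesM.

Definition WBon (A : {set 'I_n}) : {group {perm 'I_n * bool}} :=
  (WB :&: perm.Sym (finset.setX A [set: bool]))%G.

Lemma WBon_dprod (A : {set 'I_n}) :
  WBon A \x WBon (~: A) = WBon A <*> WBon (~: A).
Proof.
have fixP (B : {set 'I_n}) s x : s \in WBon B -> x.1 \notin B -> s x = x.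
  case: x => i b; rewrite inE [in X in _ && X]inE => /andP[_ Bs] /= iB.
  by apply: (out_perm Bs); rewrite finset.in_setX negb_and iB.
have stP (B : {set 'I_n}) s x : s \in WBon B -> ((s x).1 \in B) = (x.1 \in B).
  case: x => i b; rewrite inE [in X in _ && X]inE => /andP[_ Bs].
  by have := perm_closed (i, b) Bs; rewrite !inE !andbT.
apply: dprodEY.
  apply/centsP=> t Bt s As; apply/permP=> x; rewrite !permM.
  case: (boolP (x.1 \in A)) => xA.
    rewrite (fixP _ t x Bt) ?inE ?xA // (fixP _ t (s x) Bt) //.
    by rewrite inE (stP _ _ _ As) xA.
  rewrite (fixP _ s x As) // (fixP _ s (t x) As) //.
  by have := stP _ _ x Bt; rewrite !inE xA.
apply/trivgP/fintype.subsetP=> s; rewrite inE => /andP[As Bs]; rewrite inE.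
apply/eqP/permP=> x; rewrite perm1; case: (boolP (x.1 \in A)) => xA.
  by rewrite (fixP _ s x Bs) // inE xA.
by rewrite (fixP _ s x As).
Qed.

(* The restriction below goes from Sym A to the image of WBon A under absp,
   which is Sym A itself; it only adjusts the type. *)
Definition inflated (A : {set 'I_n}) (lam : seq nat) : 'CF(WBon A) :=
  cfMorph ('Res[absp @* WBon A] (specht A lam))%R.

(* The first letters, sumn xi of them, are given to xi and the others to eta. *)
Definition bipartition_char (xi eta : seq nat) : 'CF(WB) :=
  let A := [set i : 'I_n | i < sumn xi] in
  ('Ind[WB] (cfDprod (WBon_dprod A) (inflated A xi)
               (inflated (~: A) eta * 'Res[WBon (~: A)] chiB)))%R.

(* Listed from the largest part to the smallest, possibly ending with zeros. *)
Definition parts (r : seq nat) : seq nat :=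
  rev [seq nth 0 r i - i | i <- iota 0 (size r)].

(* Representations of W = WD n over Q are identified with their characters. *)
Definition Erep (L : seq nat) : 'CF(WD) :=
  ('Res[WD] (bipartition_char (parts (oddpos L)) (parts (evenpos L))))%R.

End SignedPermutations.

Section Families.
Variable n : nat.
Local Open Scope classical_set_scope.

Definition ce' : set (set 'CF(WD n)) :=
  [set c | exists2 L0, Sym' n L0 &
     c = Erep n @` [set L | Sym' n L /\ perm_eq L L0]].

Variable c : set 'CF(WD n).

(* As Erep n is injective on Sym' n, this is the equivalence class defining c. *)
Definition Symc : set (seq nat) := [set L | Sym' n L /\ c (Erep n L)].

(* The common value of pnum on Symc. *)
Definition pc : nat := xget 0 (pnum @` Symc).

Definition rep_of (Y : set (seq nat)) : 'CF(WD n) :=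
  (\sum_(L \in [set L | Symc L /\ (iota_p pc @` Y) (Lbar L)]) Erep n L)%R.

Definition newB : set 'CF(WD n) := rep_of @` Bcoll pc.-1.
Definition Con : set 'CF(WD n) := rep_of @` Ccoll pc.-1.

(* The defining property of E |-> [E], which determines it on c. *)
Definition is_bracket (br : 'CF(WD n) -> 'CF(WD n)) : Prop :=
  set_bij c newB br /\ forall E, c E -> (0 < '[br E, E])%R.

Definition Symc_as : set (seq nat) :=
  [set L | Symc L /\ size (Sset L) = pc.-1].

Definition c_as (br : 'CF(WD n) -> 'CF(WD n)) : set 'CF(WD n) :=
  [set E | c E /\ Con (br E)].

End Families.

(* Main.v *)
(* Two facts carry the proof.

   The characters E_L are pairwise orthogonal, so 0 < '[br E, E] forces E to be
   one of the summands of br E. Irreducibility is not needed for this: E_L is a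
   sub-character of the restriction to W(D_n) of two monomial characters, one
   induced from row stabilizers and one from twisted column stabilizers. If E_L
   and E_L' are not orthogonal, a Mackey summand between the row character of
   one and the column character of the other does not vanish, in both orders.
   Testing it on products of two sign changes matches the blocks of the two
   bipartitions up to a swap, and testing it on transpositions gives dominance
   between matching partitions, hence equality. The swap is excluded by the
   position of the largest entry appearing once.

   Elements of A_q are read as +-1 paths from 0 to 1 with 2q+1 steps, +1 for T.
   The number of descents of the associated sequence is at most q, with equality
   iff the path has no step from 1 to 0. Inserting a pair never destroys such a
   step, and the singleton member of B_q has one if q >= 1, so a path without
   such steps lies only in members of B_q that belong to C_q. Hence br maps
   Symc_as injectively into Con. Members of C_q are parametrized by pairs of
   binary trees, whose Dyck words below and above the level give distinct paths
   without steps from 1 to 0; so Con has at most as many elements as Symc_as and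
   the injection is a bijection. *)
Require Import Defs.
From mathcomp Require Import all_boot all_order all_algebra all_fingroup.
From mathcomp Require Import all_solvable all_field all_character.
From mathcomp Require Import zify.

Set Implicit Arguments.
Unset Strict Implicit.
Unset Printing Implicit Defensive.

(** * Interleaved sequences and words *)

Lemma filter_even_iota n :
  [seq i <- iota 0 n | ~~ odd i] = [seq k.*2 | k <- iota 0 (uphalf n)].
Proof.
elim: n => // n IHn; have -> : uphalf n.+1 = n./2 + 1 by lia.
rewrite -[n.+1]addn1 !iotaD filter_cat map_cat IHn /= !add0n.
case: ifP => on; have := odd_double_half n; have := uphalf_half n.
  by rewrite (negPf on) !add0n => -> ->.
by move=> eu _; rewrite cats0 (_ : uphalf n = n./2 + 1) ?iotaD ?map_cat //; lia.
Qed.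

Lemma filter_odd_iota n :
  [seq i <- iota 0 n | odd i] = [seq k.*2.+1 | k <- iota 0 n./2].
Proof.
elim: n => // n IHn; have -> : n.+1./2 = n./2 + odd n by lia.
rewrite -[n.+1]addn1 !iotaD filter_cat map_cat IHn /= !add0n.
case: ifP => on; have := odd_double_half n; rewrite on //.
by rewrite -[X in _ -> _ ++ [:: X] = _]odd_double_half on.
Qed.

Lemma oddposE s : oddpos s = mkseq (fun k => nth 0 s k.*2) (uphalf (size s)).
Proof. by rewrite /oddpos filter_even_iota -map_comp. Qed.

Lemma evenposE s : evenpos s = mkseq (fun k => nth 0 s k.*2.+1) (size s)./2.
Proof. by rewrite /evenpos filter_odd_iota -map_comp. Qed.

Lemma perm_oddpos_evenpos s : perm_eq (oddpos s ++ evenpos s) s.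
Proof.
rewrite -map_cat perm_sym -[X in perm_eq X _](mkseq_nth 0) perm_map //.
rewrite perm_sym perm_catC.
by rewrite (perm_filterC odd).
Qed.

Section Interleave.
Variables t b : seq nat.
Hypothesis tb : size b <= size t <= (size b).+1.

Lemma size_interleave : size (interleave t b) = size t + size b.
Proof. by rewrite size_mkseq. Qed.

Lemma oddpos_interleave : oddpos (interleave t b) = t.
Proof.
rewrite oddposE size_interleave; apply: (@eq_from_nth _ 0).
  rewrite size_mkseq; lia.
move=> i; rewrite size_mkseq => lti; rewrite nth_mkseq // nth_mkseq; last by lia.
by rewrite odd_double doubleK.
Qed.

Lemma evenpos_interleave : evenpos (interleave t b) = b.
Proof.
rewrite evenposE size_interleave; apply: (@eq_from_nth _ 0).
  rewrite size_mkseq; lia.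
move=> i; rewrite size_mkseq => lti; rewrite nth_mkseq // nth_mkseq; last by lia.
by rewrite /= odd_double /= uphalf_double.
Qed.

End Interleave.

Lemma interleaveK s : interleave (oddpos s) (evenpos s) = s.
Proof.
have es : size (oddpos s) + size (evenpos s) = size s.
  by rewrite oddposE evenposE !size_mkseq; lia.
apply: (@eq_from_nth _ 0); rewrite size_mkseq ?es // => i lti.
rewrite nth_mkseq ?es //; have := odd_double_half i.
case: (odd i) => /= ei; rewrite ?oddposE ?evenposE nth_mkseq; first by congr nth; lia.
- lia.
- by congr nth; lia.
- lia.
Qed.

Lemma interleave_rcons t b x :
  size t = (size b).+1 -> interleave t (rcons b x) = rcons (interleave t b) x.
Proof.
move=> st; apply: (@eq_from_nth _ 0).
  by rewrite size_rcons !size_mkseq size_rcons; lia.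
move=> i; rewrite size_mkseq size_rcons => lti.
rewrite nth_rcons size_mkseq nth_mkseq ?size_rcons //.
case: ltnP => lti2.
  rewrite nth_mkseq //; case: ifP => // oi; rewrite nth_rcons ifT //; lia.
have -> : i = (size b).*2.+1 by lia.
by rewrite /= odd_double /= uphalf_double nth_rcons ltnn eqxx; case: eqP => //; lia.
Qed.

(** * Splittings of an interval as words in T ([true]) and B ([false]) *)

Definition posns (c : bool) (w : seq bool) : seq nat :=
  [seq k <- iota 0 (size w) | nth (~~ c) w k == c].

Lemma posns_cat c u v :
  posns c (u ++ v) = posns c u ++ [seq size u + k | k <- posns c v].
Proof.
rewrite /posns size_cat iotaD filter_cat; congr (_ ++ _).
  apply: eq_in_filter => k; rewrite mem_iota /= => ltk.
  by rewrite nth_cat ltk.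
rewrite add0n -[X in iota X]addn0 iotaDl filter_map; congr map.
apply: eq_in_filter => k _ /=; rewrite nth_cat ltnNge leq_addr /=.
by congr (nth _ _ _ == _); lia.
Qed.

Lemma posns_cons c d w :
  posns c (d :: w) = nseq (d == c) 0 ++ [seq k.+1 | k <- posns c w].
Proof. by rewrite -cat1s posns_cat /posns /=; case: eqP. Qed.

Lemma size_posns c w : size (posns c w) = count_mem c w.
Proof.
by elim: w => //= d w IHw; rewrite posns_cons size_cat size_nseq size_map IHw.
Qed.

Lemma sorted_posns c w : sorted ltn (posns c w).
Proof. exact/(sorted_filter ltn_trans)/iota_ltn_sorted. Qed.

(** The default [~~ c] never counts as an occurrence of [c], so no bound on [k] has to be carried
    along. *)
Lemma mem_posns c w k : (k \in posns c w) = (nth (~~ c) w k == c).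
Proof.
rewrite mem_filter mem_iota /= add0n; case: ltnP; rewrite ?andbT //= => lek.
by rewrite nth_default //; case: c.
Qed.

Definition seq_of w := interleave (posns true w) (posns false w).

(** These words encode the elements of A_q: letter [k] tells whether [k] lies in T or in B. *)
Definition isword q w := (size w == q.*2.+1) && (count_mem true w == q.+1).

Lemma isword_false q w : isword q w -> count_mem false w = q.
Proof.
case/andP=> /eqP sw /eqP cw; have := count_predC (pred1 true) w.
have -> : count (predC (pred1 true)) w = count_mem false w by apply: eq_count => -[].
by rewrite cw sw; lia.
Qed.

Lemma isword_sizes q w : isword q w ->
  size (posns false w) <= size (posns true w) <= (size (posns false w)).+1.
Proof.
by move=> ww; rewrite !size_posns (isword_false ww); case/andP: ww => _ /eqP->; lia.
Qed.

Lemma seq_of_inj q w w' : isword q w -> isword q w' -> seq_of w = seq_of w' -> w = w'.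
Proof.
move=> ww ww' /(congr1 oddpos).
rewrite !oddpos_interleave ?(isword_sizes ww) ?(isword_sizes ww') // => e.
have [/andP[/eqP sw _] /andP[/eqP sw' _]] := (ww, ww').
apply: (@eq_from_nth _ false) => [|i _]; first by rewrite sw.
by have := mem_posns true w i; rewrite e mem_posns; case: nth; case: nth.
Qed.

Definition ins i (c : bool) (w : seq bool) := take i w ++ [:: c, ~~ c & drop i w].

Lemma isword_ins q w i c : isword q w -> isword q.+1 (ins i c w).
Proof.
case/andP=> /eqP sw /eqP cw; rewrite /isword /ins size_cat /= count_cat /=.
move: sw cw; rewrite -{1 2}(cat_take_drop i w) size_cat count_cat.
by case: c => /=; lia.
Qed.

(** The relabelling shifts by two the positions from [i] on, which is the effect of inserting two
    consecutive letters there. *)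
Lemma insert_pair_seq_of q i c w : isword q w -> i <= q.*2.+1 ->
  insert_pair i c (seq_of w) = seq_of (ins i c w).
Proof.
move=> ww lei; rewrite /insert_pair /split_seq.
rewrite oddpos_interleave ?evenpos_interleave ?(isword_sizes ww) //.
have {}lei : i <= size w by case/andP: ww => /eqP->.
(* Both rows are treated at once: row [d] receives [i] if [c] is its letter and [i.+1] otherwise.
   The two sides are sorted, so they need only agree up to permutation. *)
suff E d : sort leq ((if c == d then i else i.+1)
             :: [seq if k < i then k else k.+2 | k <- posns d w]) = posns d (ins i c w).
  by rewrite /seq_of -!E; case: c {E}.
apply: (sorted_eq leq_trans anti_leq).
- exact/sort_sorted/leq_total.
- exact/(sub_sorted ltnW)/sorted_posns.
rewrite perm_sort -{1}(cat_take_drop i w) /ins !posns_cat map_cat.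
have -> : [seq (if k < i then k else k.+2) | k <- posns d (take i w)] = posns d (take i w).
  rewrite -[RHS]map_id; apply/eq_in_map => k; rewrite mem_filter mem_iota.
  by rewrite size_takel // => /and3P[_ _ ltk]; rewrite ifT.
rewrite -cat1s perm_catCA perm_cat2l !posns_cons !map_cat -!map_comp size_takel //.
have -> : [seq i + k.+2 | k <- posns d (drop i w)] =
   [seq (if i + k < i then i + k else (i + k).+2) | k <- posns d (drop i w)].
  by apply: eq_map => k /=; case: ltnP; lia.
by case: c; case: d; rewrite /= ?addn0 ?addn1.
Qed.

(** With T as +1 and B as -1, the height after a prefix is its number of T minus its number of B;
    the condition forbids a B-step that starts at height 1. *)
Definition nodrop w :=
  forall u v, w = u ++ false :: v -> count_mem true u != (count_mem false u).+1.

(** The inserted pair has total height 0, so every step of [w] keeps its starting height in the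
    longer path. The pair lands either after the step considered or before it. *)
Lemma nodrop_ins i c w : nodrop (ins i c w) -> nodrop w.
Proof.
move=> nd u v e; have := nd _ _ _; rewrite /ins.
case: (ltnP (size u) i) => [lt|le]; rewrite e.
  rewrite take_cat drop_cat ltnNge (ltnW lt) /=.
  have : 0 < i - size u by lia.
  case: (i - size u) => // k _ /= H.
  by have := H u (take k v ++ [:: c, ~~ c & drop k v]); rewrite -catA; apply.
move=> H; have := H (take i u ++ [:: c, ~~ c & drop i u]) v.
have -> : take i (u ++ false :: v) = take i u.
  rewrite take_cat; case: ltnP => // ge; have -> : i = size u by lia.
  by rewrite subnn take0 cats0 take_size.
have -> : drop i (u ++ false :: v) = drop i u ++ false :: v.
  rewrite drop_cat; case: ltnP => // ge.
  by rewrite (_ : i = size u) ?subnn ?drop0 ?drop_size //; lia.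
rewrite -catA /= => /(_ erefl); rewrite !count_cat /=.
by rewrite -[in X in _ -> X](cat_take_drop i u) !count_cat; case: (c) => /=; lia.
Qed.

(** * Binary trees, noncrossing matchings and Dyck words *)

Inductive tree := Leaf | Node of tree & tree.

Fixpoint nodes t := if t is Node a b then (nodes a + nodes b).+1 else 0.

Fixpoint dyck c t : seq bool :=
  if t is Node a b then c :: dyck c a ++ ~~ c :: dyck c b else [::].

(** A tree is a noncrossing matching of positions, each node matching two of them. The language
    consists of all words giving opposite letters to matched positions; [dyck c t] is the one in
    which every pair opens with [c]. *)
Inductive lang : tree -> seq bool -> Prop :=
| lang_leaf : lang Leaf [::]
| lang_node a b u v c : lang a u -> lang b v ->
    lang (Node a b) (c :: u ++ ~~ c :: v).

Lemma lang_dyck c t : lang t (dyck c t).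
Proof. by elim: t => [|a IHa b IHb] /=; constructor. Qed.

Lemma lang_size t u : lang t u -> size u = (nodes t).*2.
Proof. by elim=> //= a b u' v c _ IHu _ IHv; rewrite size_cat /= IHu IHv; lia. Qed.

(** All words of [t] share their length and their matched positions, so the node created by the new
    pair depends only on [i]. *)
Lemma lang_ins t i : i <= (nodes t).*2 ->
  exists2 t', nodes t' = (nodes t).+1 &
    forall w, lang t' w <-> exists c u, lang t u /\ w = ins i c u.
Proof.
(* A pair inserted in front becomes a new root with empty left subtree. *)
have base s : exists2 t', nodes t' = (nodes s).+1 &
    forall w, lang t' w <-> exists c u, lang s u /\ w = ins 0 c u.
  exists (Node Leaf s) => // w; split=> [lw|[c [u [lu ->]]]].
    inversion lw as [|a b u v c lu lv]; subst; inversion lu; subst.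
    by exists c, v; rewrite /ins take0 drop0.
  by rewrite /ins take0 drop0; exact: (lang_node c lang_leaf lu).
elim: t i => [|a IHa b IHb] [|i] lei; [exact: base | by [] | exact: base |].
rewrite /= in lei *; case: (leqP i (nodes a).*2) => lea.
  have [a' sa' la'] := IHa i lea; exists (Node a' b); first by rewrite /= sa'.
  have E d u c v : lang a u ->
    ins i.+1 d (c :: u ++ ~~ c :: v) = c :: ins i d u ++ ~~ c :: v.
    move=> /lang_size su; rewrite /ins /= -catA /=; congr (_ :: _).
    rewrite take_cat drop_cat su; case: ltnP => // ge.
    have -> : i = (nodes a).*2 by lia.
    by rewrite subnn take0 cats0 drop0 take_oversize ?drop_oversize ?su.
  move=> w; split=> [lw|[d [x [lx ->]]]].
    inversion lw as [|a1 b1 u1 v c lu lv]; subst.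
    have [d [u [lau ->]]] := (la' _).1 lu; exists d, (c :: u ++ ~~ c :: v).
    by split; [constructor | rewrite E].
  inversion lx as [|a1 b1 u v c lu lv]; subst; rewrite E //; constructor=> //.
  by apply/la'; exists d, u.
(* From position [i.+1], remove the opening letter of the root, the left word and the closing
   letter: an index in the right word is left. *)
have [b' sb' lb'] := IHb (i - (nodes a).*2.+1) ltac:(lia).
exists (Node a b'); first by rewrite /= sb'; lia.
have E d u c v : lang a u ->
  ins i.+1 d (c :: u ++ ~~ c :: v) = c :: u ++ ~~ c :: ins (i - (nodes a).*2.+1) d v.
  move=> /lang_size su; rewrite /ins /=; congr (_ :: _).
  rewrite take_cat drop_cat su ltnNge (ltnW lea) /= -catA /=.
  by have -> : i - (nodes a).*2 = (i - (nodes a).*2.+1).+1 by lia.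
move=> w; split=> [lw|[d [x [lx ->]]]].
  inversion lw as [|a1 b1 u v1 c lu lv]; subst.
  have [d [v [lbv ->]]] := (lb' _).1 lv; exists d, (c :: u ++ ~~ c :: v).
  by split; [constructor | rewrite E].
inversion lx as [|a1 b1 u v c lu lv]; subst; rewrite E //; constructor=> //.
by apply/lb'; exists d, v.
Qed.

Lemma dyck_count c t : count_mem c (dyck c t) = count_mem (~~ c) (dyck c t).
Proof.
elim: t => //= a IHa b IHb; rewrite !count_cat /= IHa IHb.
by case: c {IHa IHb} => /=; lia.
Qed.

Lemma cat_eq_split (T : eqType) (u v x y : seq T) :
  u ++ v = x ++ y -> size u <= size x -> exists2 r, x = u ++ r & v = r ++ y.
Proof.
move=> e le; have ex : x = u ++ drop (size u) x.
  rewrite -{1}(cat_take_drop (size u) x); congr (_ ++ _).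
  by have /esym := congr1 (take (size u)) e; rewrite takel_cat // take_size_cat.
exists (drop (size u) x) => //; move/eqP: e; rewrite {1}ex -catA eqseq_cat // eqxx.
by move/eqP.
Qed.

Lemma dyck_prefix c t u v : dyck c t = u ++ v -> count_mem (~~ c) u <= count_mem c u.
Proof.
elim: t u v => [|a IHa b IHb] [|x u] v //= [<- e].
have ca := dyck_count c a; have -> : (c == ~~ c) = false by case: (c).
case: (leqP (size u) (size (dyck c a))) => le.
  have [r E _] := cat_eq_split (esym e) le.
  exact: leq_trans (IHa _ _ E) (leq_addl _ _).
have [[|y u'] E E'] := cat_eq_split e (ltnW le); first by rewrite E cats0 ltnn in le.
case: E' => ey /IHb; rewrite E -ey !count_cat /= ca.
by case: (c) => /=; lia.
Qed.

(** Unique parsing: no word [dyck c t] begins with [~~ c], so the next letter decides whether the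
    current tree is a leaf. *)
Lemma dyck_cat_inj c a a' x y :
  dyck c a ++ ~~ c :: x = dyck c a' ++ ~~ c :: y -> a = a' /\ x = y.
Proof.
elim: a a' x y => [|a1 IH1 a2 IH2] [|b1 b2] x y /=.
- by case.
- by case: (c).
- by case: (c).
by rewrite -!catA /= => -[/IH1[-> /IH2[-> ->]]].
Qed.

(** The path stays at heights at most 0, then steps once from 0 to 1, then stays at heights at least
    1. *)
Definition canon_word a b := dyck false a ++ true :: dyck true b.

Lemma canon_inj a b a' b' : canon_word a b = canon_word a' b' -> a = a' /\ b = b'.
Proof.
move=> /(@dyck_cat_inj false)[-> e]; split=> //.
(* Unique parsing needs a closing letter, so one is appended to both words. *)
by have := @dyck_cat_inj true b b' [::] [::]; rewrite e => /(_ erefl)[].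
Qed.

Lemma isword_canon a b : isword (nodes a + nodes b) (canon_word a b).
Proof.
have H c t : count_mem true (dyck c t) = nodes t /\ size (dyck c t) = (nodes t).*2.
  have s := lang_size (lang_dyck c t); split=> //.
  have := count_predC (pred1 true) (dyck c t); have := dyck_count c t.
  rewrite (@eq_count _ (predC (pred1 true)) (pred1 false)); last by case.
  by case: c s => /=; lia.
rewrite /isword /canon_word size_cat count_cat /=.
by have [-> ->] := H false a; have [-> ->] := H true b; apply/andP; split; apply/eqP; lia.
Qed.

Lemma nodrop_canon a b : nodrop (canon_word a b).
Proof.
move=> u v; rewrite /canon_word => e.
case: (ltnP (size u) (size (dyck false a))) => le.
  by have [r E _] := cat_eq_split (esym e) (ltnW le); have /= := dyck_prefix E; lia.
have [[|x u'] -> //] := cat_eq_split e le => -[<- e'].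
have := @dyck_prefix true b (rcons u' false) v; rewrite cat_rcons => /(_ e').
rewrite -cats1 !count_cat /=; have /= := dyck_count false a; lia.
Qed.

(** * Descents and steps from 1 to 0 *)

(** Positions 2k+1 and 2k+2 of an interleaved sequence are the two comparisons involving entry k of
    the second row; the last position stands alone. *)
Lemma size_filter_pairs (P : pred nat) q :
  size [seq j <- iota 1 q.*2.+1 | P j] =
  \sum_(k < q) (P k.*2.+1 + P k.*2.+2) + P q.*2.+1.
Proof.
elim: q => [|q IHq]; first by rewrite big_ord0 /=; case: (P 1).
have -> : q.+1.*2.+1 = q.*2.+1 + 2 by lia.
rewrite iotaD filter_cat size_cat IHq big_ord_recr /= !add1n addn2.
by case: (P q.*2.+2); case: (P q.*2.+3) => /=; lia.
Qed.

Lemma sum_eq_card q (F : nat -> nat) : (forall k, k < q -> F k <= 1) ->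
  \sum_(k < q) F k = q <-> forall k, k < q -> F k = 1.
Proof.
elim: q => [|q IHq] F1; first by rewrite big_ord0.
have lq : \sum_(k < q) F k <= q.
  rewrite -[X in _ <= X]muln1 -[X in _ <= X * _](card_ord q) -sum_nat_const.
  by apply: leq_sum => k _; apply: F1; rewrite ltnS ltnW.
have {}IHq := IHq (fun k lt => F1 k (ltnW lt)).
have -> : \sum_(k < q.+1) F k = \sum_(k < q) F k + F q by rewrite big_ord_recr.
have := F1 q (leqnn _) => Fq; split=> [e k|F_1].
  rewrite ltnS leq_eqVlt => /predU1P[->|]; first by lia.
  by apply: (IHq.1 _ k); lia.
by rewrite F_1 ?leqnn // (IHq.2 _) ?addn1 // => k lt; apply: F_1; apply: ltnW.
Qed.

(** As [t] increases, [s_k < t_k] and [t_{k+1} < s_k] exclude each other, so each pair of positions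
    gives at most one descent. The last position gives none because [t_q < s_q]. *)
Lemma full_descents q t s : size t = q.+1 -> size s = q.+1 -> sorted ltn t ->
  nth 0 t q < nth 0 s q ->
  size [seq j <- iota 1 q.*2.+1 |
          nth 0 (interleave t s) j < nth 0 (interleave t s) j.-1] = q <->
  forall k, k < q -> (nth 0 s k < nth 0 t k) || (nth 0 t k.+1 < nth 0 s k).
Proof.
move=> st ss sot lq.
have et k : k <= q -> nth 0 (interleave t s) k.*2 = nth 0 t k.
  by move=> le; rewrite nth_mkseq ?odd_double ?doubleK //; lia.
have es k : k <= q -> nth 0 (interleave t s) k.*2.+1 = nth 0 s k.
  by move=> le; rewrite nth_mkseq /= ?odd_double /= ?uphalf_double //; lia.
rewrite (size_filter_pairs (fun j => nth 0 (interleave t s) j < nth 0 (interleave t s) j.-1)).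
rewrite /= et // es // [_ < nth 0 t q]ltnNge (ltnW lq) addn0.
pose F k := (nth 0 s k < nth 0 t k) + (nth 0 t k.+1 < nth 0 s k).
have -> : \sum_(k < q) ((nth 0 (interleave t s) k.*2.+1 < nth 0 (interleave t s) k.*2) +
    (nth 0 (interleave t s) k.*2.+2 < nth 0 (interleave t s) k.*2.+1)) = \sum_(k < q) F k.
  by apply: eq_bigr => k _; rewrite -doubleS !et ?es // ltnW.
have tk k : k < q -> nth 0 t k < nth 0 t k.+1.
  by move=> lt; apply: (sorted_ltn_nth ltn_trans 0 sot); rewrite ?inE ?st //; lia.
rewrite sum_eq_card; last by move=> k /tk; rewrite /F; lia.
by split=> H k lt; have := H k lt; have := tk k lt; rewrite /F; lia.
Qed.

Lemma posns_rcons c d w : posns c (rcons w d) = posns c w ++ nseq (d == c) (size w).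
Proof.
by rewrite -cats1 posns_cat posns_cons; case: (d == c); rewrite /= ?addn0.
Qed.

Lemma nth_posns_ltn c u v k : k < size (posns c (u ++ v)) ->
  (nth 0 (posns c (u ++ v)) k < size u) = (k < count_mem c u).
Proof.
rewrite posns_cat size_cat size_map => lt; rewrite nth_cat size_posns.
case: (ltnP k (count_mem c u)) => [lt1|ge].
  have : nth 0 (posns c u) k \in posns c u by rewrite mem_nth // size_posns.
  by rewrite mem_filter mem_iota => /and3P[].
have lt' : k - count_mem c u < size (posns c v) by move: lt; rewrite size_posns; lia.
by rewrite (nth_map 0) // ltnNge leq_addr.
Qed.

Lemma nth_posns_split w k : k < count_mem false w ->
  exists u v, [/\ w = u ++ false :: v, count_mem false u = k & nth 0 (posns false w) k = size u].
Proof.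
elim: w k => [|d w IHw] //= k; case: d => /=.
  move=> /IHw[u [v [-> <- e]]]; exists (true :: u), v; split=> //.
  by rewrite posns_cons /= (nth_map 0) ?e // size_posns count_cat /= addnA addn1 ltnS leq_addr.
case: k => [_|k]; first by exists [::], w; rewrite posns_cons.
rewrite add1n ltnS => /[dup] lt /IHw[u [v [ew eu e]]]; exists (false :: u), v.
split; [by rewrite ew | by rewrite /= eu | rewrite posns_cons /= (nth_map 0) ?e //].
by rewrite size_posns.
Qed.

(** Counting from 0, the k-th B is preceded by k letters B. Its step starts at height 1 iff exactly
    k+1 letters T precede it, that is, iff it lies between the k-th and the (k+1)-st T. *)
Lemma nodropP q w : isword q w -> nodrop w <-> forall k, k < q ->
  (nth 0 (posns false w) k < nth 0 (posns true w) k)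
  || (nth 0 (posns true w) k.+1 < nth 0 (posns false w) k).
Proof.
move=> ww; have cf := isword_false ww; have /andP[_ /eqP ct] := ww.
have key u v : w = u ++ false :: v ->
  (size u < nth 0 (posns true w) (count_mem false u)) ||
  (nth 0 (posns true w) (count_mem false u).+1 < size u) =
  (count_mem true u != (count_mem false u).+1).
  move=> e; have le : (count_mem false u) < q by rewrite -cf e count_cat /=; lia.
  have E k : k <= q -> (nth 0 (posns true w) k < size u) = (k < count_mem true u).
    by move=> lek; rewrite e nth_posns_ltn // -e size_posns ct.
  rewrite E // ltn_neqAle leqNgt E ?(ltnW le) //.
  suff -> : size u == nth 0 (posns true w) (count_mem false u) = false by lia.
  apply/eqP => eu.
  have : size u \in posns true w by rewrite eu mem_nth // size_posns ct; lia.
  by rewrite mem_posns e nth_cat ltnn subnn.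
split=> [nd k ltk|H u v e]; last first.
  rewrite -(key _ _ e); have := H (count_mem false u).
  have -> : nth 0 (posns false w) (count_mem false u) = size u.
    by rewrite e posns_cat nth_cat size_posns ltnn subnn posns_cons /= addn0.
  by apply; rewrite -cf e count_cat /=; lia.
rewrite -cf in ltk; have [u [v [e <- ->]]] := nth_posns_split ltk.
by rewrite (key _ _ e); apply: nd e.
Qed.

(** Labels from an increasing [z] compare as their positions do, which reduces descents to the
    criterion for [nodrop]. The appended [false] puts the largest label at the end of the second
    row. *)
Lemma descents_word q w (z : seq nat) : isword q w -> sorted ltn z -> size z = q.*2.+2 ->
  let r c := [seq nth 0 z k | k <- posns c (rcons w false)] in
  size [seq j <- iota 1 q.*2.+1 |
    nth 0 (interleave (r true) (r false)) j < nth 0 (interleave (r true) (r false)) j.-1] = q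
  <-> nodrop w.
Proof.
move=> ww sz szz r; have cf := isword_false ww; have /andP[/eqP sw /eqP ct] := ww.
have zlt i j : i < q.*2.+2 -> j < q.*2.+2 -> (nth 0 z i < nth 0 z j) = (i < j).
  move=> lti ltj; case: (ltngtP i j) => [lt|gt|->]; last by rewrite ltnn.
    by rewrite (sorted_ltn_nth ltn_trans) ?inE ?szz.
  by apply/negbTE; rewrite -leqNgt ltnW // (sorted_ltn_nth ltn_trans) ?inE ?szz.
have lt c k : k < size (posns c w) -> nth 0 (posns c w) k < q.*2.+1.
  move=> lt; have := mem_nth 0 lt; rewrite mem_filter mem_iota sw.
  by case/and3P.
have sp c k : k < count_mem c w -> nth 0 (r c) k = nth 0 z (nth 0 (posns c w) k).
  move=> ltk; rewrite (nth_map 0) posns_rcons ?nth_cat ?size_cat size_posns ?ltk //.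
  exact: ltn_addr.
have rq : nth 0 (r false) q = nth 0 z q.*2.+1.
  rewrite (nth_map 0) posns_rcons ?size_cat ?nth_cat size_posns cf ?ltnn ?subnn /= ?sw //.
  by rewrite addn1.
rewrite full_descents ?size_map ?posns_rcons ?size_cat ?size_posns ?ct ?cf /= ?addn0 ?addn1 //.
- rewrite (nodropP ww); split=> H k ltk; have := H k ltk;
    by rewrite !sp ?ct ?cf ?zlt //; try (apply: ltnW; apply: lt; rewrite size_posns ?ct ?cf; lia); lia.
- rewrite /r posns_rcons cats0; apply/(homo_sorted_in _ (P := gtn q.*2.+2)); last exact: sorted_posns.
    by move=> i j; rewrite !inE => lti ltj; have := zlt i j lti ltj => /= ->.
  by apply/allP => k; rewrite mem_filter mem_iota sw !inE => /and3P[_ _]; lia.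
- by rewrite rq sp ?ct // zlt ?lt // ?size_posns ?ct //; apply: ltnW; rewrite ltnS lt // size_posns ct.
Qed.

(** * Words of symbols *)

Section Rows.
Variable L : seq nat.
Hypotheses (sto : sorted ltn (oddpos L)) (ste : sorted ltn (evenpos L)).

Definition zs := sort leq (singles L).
Definition lword := [seq x \in oddpos L | x <- zs].

Lemma count_rows x : count_mem x L = (x \in oddpos L) + (x \in evenpos L).
Proof.
rewrite -(seq.permP (perm_oddpos_evenpos L)) count_cat !count_uniq_mem //;
  exact: sorted_uniq ltn_trans ltnn _ _.
Qed.

Lemma once_rows x : once L x = (x \in oddpos L) (+) (x \in evenpos L).
Proof. by rewrite /once count_rows; case: (_ \in _); case: (_ \in _). Qed.

Lemma mem_singles x : (x \in singles L) = once L x.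
Proof.
rewrite mem_filter andb_idr // once_rows -(perm_mem (perm_oddpos_evenpos L)) mem_cat.
by case: (_ \in _).
Qed.

Lemma zs_sorted : sorted ltn zs.
Proof.
rewrite ltn_sorted_uniq_leq sort_sorted ?andbT; last exact: leq_total.
rewrite sort_uniq; apply/count_mem_uniq => x; rewrite mem_singles count_filter.
case o: (once L x).
  rewrite [RHS]/= -(eqP o : count_mem x L = 1); apply: eq_count => y /=.
  by case: eqP => //= ->.
apply/eqP; rewrite eqn0Ngt -has_count; apply/hasPn => y _ /=.
by apply/negP => /andP[/eqP->]; rewrite o.
Qed.

Lemma mem_zs x : (x \in zs) = once L x.
Proof. by rewrite mem_sort mem_singles. Qed.

Lemma posns_lword c : posns c lword =
  [seq k <- iota 0 (size zs) | nth 0 zs k \in if c then oddpos L else evenpos L].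
Proof.
rewrite /posns size_map; apply: eq_in_filter => k; rewrite mem_iota => /andP[_ ltk].
rewrite (nth_map 0) //; have := mem_nth 0 ltk; rewrite mem_zs once_rows.
by case: c; case: (_ \in oddpos L); case: (_ \in evenpos L).
Qed.

Lemma Lbar_lword : Lbar L = seq_of lword.
Proof. by rewrite /seq_of !posns_lword. Qed.

Lemma row_singles c :
  [seq x <- if c then oddpos L else evenpos L | once L x] =
  [seq nth 0 zs k | k <- posns c lword].
Proof.
have -> : [seq x <- if c then oddpos L else evenpos L | once L x] =
          [seq x <- zs | x \in if c then oddpos L else evenpos L].
  apply: (irr_sorted_eq ltn_trans ltnn).
  - by apply: (sorted_filter ltn_trans); case: c.
  - exact/(sorted_filter ltn_trans)/zs_sorted.
  by move=> x; rewrite !mem_filter mem_zs andbC.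
rewrite posns_lword -[X in filter _ X = _](mkseq_nth 0) filter_map.
by congr map.
Qed.

Lemma reduced_lword : reduced L =
  interleave [seq nth 0 zs k | k <- posns true lword]
             [seq nth 0 zs k | k <- posns false lword].
Proof. by rewrite -!row_singles. Qed.

(** Strictly increasing rows force a repeated entry to occur exactly once in each. *)
Lemma perm_doubles :
  perm_eq [seq x <- oddpos L | ~~ once L x] [seq x <- evenpos L | ~~ once L x].
Proof.
apply: uniq_perm; try exact/filter_uniq/(sorted_uniq ltn_trans ltnn).
by move=> x; rewrite !mem_filter once_rows; do 2 case: (_ \in _).
Qed.

Lemma max_singles : \max_(x <- singles L) x = last 0 zs.
Proof.
have -> : \max_(x <- singles L) x = \max_(x <- zs) x.
  by apply: perm_big; rewrite perm_sym perm_sort.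
have := sort_sorted leq_total (singles L); rewrite -/zs; move: zs => z sz.
apply/anti_leq/andP; split; last first.
  by case: z {sz} => // x z /=; apply: leq_bigmax_seq; rewrite // mem_last.
apply/bigmax_leqP_seq => x /(nthP 0)[i lti <-] _; rewrite -nth_last.
have lt0 : 0 < size z by case: size lti.
by apply: (sorted_leq_nth leq_trans leqnn 0 sz); rewrite ?inE ?prednK // -ltnS prednK.
Qed.

End Rows.

Lemma Sym'_sorted n L : Sym' n L -> sorted ltn (oddpos L) /\ sorted ltn (evenpos L).
Proof. by case=> m _ []. Qed.

(** The rows have equal length and share the repeated entries, so the word has as many T as B. Its
    last letter is B because the largest entry appearing once is in an even position; removing it
    leaves one T in excess. *)
Lemma lword_Sym' n L : Sym' n L ->
  exists w q, [/\ lword L = rcons w false, isword q w & pnum L = q.+1].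
Proof.
move=> [m m1 [sL [sto ste] _ _ [ns mx]]].
have sz : size (zs L) = size (singles L) by rewrite size_sort.
have szc c : count_mem c (lword L) =
    size [seq x <- if c then oddpos L else evenpos L | once L x].
  by rewrite row_singles // size_map size_posns.
have eqc : count_mem true (lword L) = count_mem false (lword L).
  have h s : count (once L) s + count (fun x => ~~ once L x) s = size s.
    exact: count_predC.
  have := perm_size (perm_doubles sto ste); rewrite !szc !size_filter => pd.
  apply/eqP; rewrite -(eqn_add2r (count (fun x => ~~ once L x) (evenpos L))) h -pd h.
  by rewrite oddposE evenposE !size_mkseq sL uphalf_double doubleK.
have cC := count_predC (pred1 true) (lword L).
rewrite (@eq_count _ (predC (pred1 true)) (pred1 false)) in cC; last by case.
case/lastP E : (lword L) => [|w c].
  case: ns; apply/nilP; rewrite /nilp -sz; have := congr1 size E.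
  by rewrite size_map => ->.
have c0 : c = false.
  have [i lti ei] : exists2 i, i < size (zs L) & i.+1 = size (zs L).
    by have := congr1 size E; rewrite size_map size_rcons => ->; exists (size w).
  have : last true (lword L) = c by rewrite E last_rcons.
  rewrite -nth_last size_map -ei /= (nth_map 0) // => <-.
  have := mx; rewrite max_singles // -nth_last -ei /=.
  have := mem_nth 0 lti; rewrite mem_zs // once_rows // => o e.
  by rewrite e addbT in o; apply/negbTE.
subst c; move: eqc cC; rewrite E -cats1 !count_cat size_cat /= => eqc cC.
have ct : count_mem true w = (count_mem false w).+1.
  exact: etrans (esym (addn0 _)) (etrans eqc (addn1 _)).
have sw : size w = (count_mem false w).*2.+1.
  by move: cC; rewrite eqc; set c := count_mem _ w => cC; lia.
exists w, (count_mem false w); split=> //; first by rewrite cats1.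
  by rewrite /isword ct sw !eqxx.
have : size (singles L) = size (lword L) by rewrite size_map size_sort.
by rewrite /pnum E size_rcons sw => ->; rewrite -doubleS doubleK.
Qed.

Lemma Lbar_Sym' n L w : Sym' n L -> lword L = rcons w false -> isword (pnum L).-1 w ->
  Lbar L = iota_p (pnum L) (seq_of w).
Proof.
move=> SL ew ww; have [sto ste] := Sym'_sorted SL.
have [_ [q [_ _ eq]]] := lword_Sym' SL; rewrite eq /= in ww *.
rewrite Lbar_lword // ew /seq_of !posns_rcons /= cats0 cats1 interleave_rcons.
  by rewrite /iota_p; case/andP: ww => /eqP-> _; rewrite doubleS.
by rewrite !size_posns (isword_false ww); case/andP: ww => _ /eqP.
Qed.

Lemma Sset_Sym' n L w : Sym' n L -> lword L = rcons w false -> isword (pnum L).-1 w ->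
  size (Sset L) = (pnum L).-1 <-> nodrop w.
Proof.
move=> SL ew ww; have [sto ste] := Sym'_sorted SL.
have [_ [q [_ _ eq]]] := lword_Sym' SL; rewrite /Sset reduced_lword // eq -[q.+1.-1]/q in ww *.
rewrite ew doubleS -[q.*2.+2.-1]/(q.*2.+1); apply: (descents_word ww); first exact: zs_sorted.
have := congr1 size ew; rewrite size_map => ->.
by rewrite size_rcons; case/andP: ww => /eqP->.
Qed.

(** The repeated entries stay in both rows, while those appearing once are redistributed as
    [rcons w false] prescribes. *)
Lemma Sym'_of_word n L0 w : Sym' n L0 -> isword (pnum L0).-1 w ->
  exists L, [/\ Sym' n L, perm_eq L L0 & lword L = rcons w false].
Proof.
move=> SL0; have [w0 [q [ew0 ww0 ->]]] := lword_Sym' SL0; rewrite /= => ww.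
have [sto ste] := Sym'_sorted SL0.
pose z := zs L0; have szz : size z = q.*2.+2.
  have := congr1 size ew0; rewrite size_map => ->.
  by rewrite size_rcons; case/andP: ww0 => /eqP->.
have usz : uniq z by apply: sorted_uniq ltn_trans ltnn _ (zs_sorted sto ste).
pose r c := [seq nth 0 z k | k <- posns c (rcons w false)].
pose D := [seq x <- oddpos L0 | ~~ once L0 x].
have sw : size (rcons w false) = size z.
  by rewrite size_rcons szz; case/andP: ww => /eqP->.
have mr c x : (x \in r c) = (x \in z) && (nth (~~ c) (rcons w false) (index x z) == c).
  apply/mapP/andP => [[k kp ->]|[xz]].
    have := kp; rewrite mem_filter mem_iota sw => /and3P[kc _ ltk].
    by rewrite index_uniq // mem_nth // kc.
  by rewrite -mem_posns => xp; exists (index x z); rewrite ?nth_index.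
have ur c : uniq (r c).
  rewrite map_inj_in_uniq; first exact: sorted_uniq ltn_trans ltnn _ (sorted_posns _ _).
  move=> i j; rewrite !mem_filter !mem_iota sw => /and3P[_ _ lti] /and3P[_ _ ltj] /eqP.
  by rewrite nth_uniq // => /eqP.
have rD c : uniq (r c ++ D).
  rewrite cat_uniq ur filter_uniq ?andbT; last exact: sorted_uniq ltn_trans ltnn _ sto.
  apply/hasPn => x; rewrite mem_filter => /andP[nx _] /=; rewrite mr mem_zs //.
  by rewrite (negPf nx).
have pz : perm_eq (r true ++ r false) z.
  rewrite -map_cat perm_sym -[X in perm_eq X](mkseq_nth 0) perm_map //.
  apply: uniq_perm; rewrite ?iota_uniq //.
    rewrite cat_uniq; apply/and3P; split; try exact: sorted_uniq ltn_trans ltnn _ (sorted_posns _ _).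
    apply/hasPn => k /=; rewrite mem_filter mem_iota => /and3P[/eqP kf _ ltk].
    by rewrite mem_posns (set_nth_default (~~ false)) // kf.
  move=> k; rewrite mem_cat !mem_posns mem_iota /= add0n -sw.
  case: ltnP => lt; last by rewrite !nth_default.
  by rewrite (set_nth_default true) //; case: nth.
pose row c := sort leq (r c ++ D); pose L := interleave (row true) (row false).
have srow : size (row true) = size (row false).
  rewrite !size_sort !size_cat !size_map !posns_rcons !size_cat !size_posns.
  by rewrite (isword_false ww) /=; case/andP: ww => _ /eqP->; lia.
have eo : oddpos L = row true by rewrite oddpos_interleave // srow leqnn leqnSn.
have ee : evenpos L = row false by rewrite evenpos_interleave // srow leqnn leqnSn.
have rsort c : sorted ltn (row c).
  by rewrite ltn_sorted_uniq_leq sort_sorted ?andbT ?sort_uniq //; apply: leq_total.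
have pL : perm_eq L L0.
  apply/seq.permP => a; rewrite -(seq.permP (perm_oddpos_evenpos L)) eo ee count_cat.
  rewrite !(seq.permP (permEl (perm_sort _ _))) !count_cat.
  have := seq.permP pz a; rewrite count_cat (seq.permP (permEl (perm_sort _ _))).
  rewrite -(seq.permP (permEl (perm_filterC (once L0) L0))) count_cat -/(singles L0) => <-.
  have pd : perm_eq [seq x <- L0 | ~~ once L0 x] (D ++ D).
    apply: (perm_trans (y := [seq x <- oddpos L0 ++ evenpos L0 | ~~ once L0 x])).
      by apply: perm_filter; rewrite perm_sym perm_oddpos_evenpos.
    by rewrite filter_cat perm_cat2l perm_sym; apply: perm_doubles.
  by rewrite (seq.permP pd) count_cat; lia.
have eonce : once L =1 once L0 by move=> x; rewrite /once (seq.permP pL).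
have psing : perm_eq (singles L) (singles L0).
  by rewrite /singles (eq_filter eonce); apply: perm_filter.
have ezs : zs L = z by apply/perm_sortP => //; [apply: leq_total|apply: leq_trans|apply: anti_leq].
have el : lword L = rcons w false.
  apply: (@eq_from_nth _ false); rewrite size_map ezs ?sw // => i lti.
  rewrite /lword eo (nth_map 0) ?ezs // mem_sort mem_cat mr mem_nth // index_uniq // mem_filter.
  have := mem_nth 0 lti; rewrite mem_zs // => -> /=; rewrite orbF.
  by case: nth.
exists L; split=> //; have [m m1 [sL _ suL c0 [ns mx]]] := SL0.
exists m => //; split.
- by rewrite (perm_size pL).
- by rewrite eo ee.
- by rewrite (perm_sumn pL).
- by rewrite (seq.permP pL).
split.
  by move=> e; move: psing; rewrite e perm_sym => /perm_nilP.
rewrite (perm_big _ psing) /= max_singles // ee mem_sort mem_cat mr -nth_last szz /=.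
rewrite mem_nth ?szz // index_uniq ?szz // nth_rcons.
have -> : size w = q.*2.+1 by case/andP: ww => /eqP.
by rewrite ltnn eqxx.
Qed.

Import Order.TTheory GRing.Theory Num.Theory.

(** * Sub-characters and the Mackey formula *)

Section Characters.
Local Open Scope ring_scope.

Definition subchar (gT : finGroupType) (G : {group gT}) (a b : 'CF(G)) :=
  a \is a character /\ b - a \is a character.

Section SubChar.
Variables (gT : finGroupType) (G : {group gT}).
Implicit Types a b c : 'CF(G).

Lemma subchar_char a b : subchar a b -> b \is a character.
Proof. by case=> ca cba; rewrite -(subrK a b) rpredD. Qed.

(** Scalar products of characters are nonnegative, so when their sum ['[b, b']] vanishes each of
    them does. *)
Lemma subchar_cfdot a b a' b' :
  subchar a b -> subchar a' b' -> '[b, b'] = 0 -> '[a, a'] = 0.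
Proof.
move=> sab sab'; have cb' := subchar_char sab'.
case: sab sab' => ca cba [ca' cba'].
have ge0 (u v : 'CF(G)) : u \is a character -> v \is a character -> 0 <= '[u, v].
  by move=> cu cv; apply/natr_ge0/Cnat_cfdot_char.
rewrite -[b](subrK a) cfdotDl -[X in '[a, X]](subrK a') cfdotDr addrA => /eqP.
by rewrite paddr_eq0 ?addr_ge0 ?ge0 // => /andP[_ /eqP].
Qed.

Lemma subcharMr a b c : c \is a character -> subchar a b -> subchar (a * c) (b * c).
Proof. by move=> cc [ca cba]; split; rewrite -?mulrBl rpredM. Qed.

Lemma subchar_Ind (H : {group gT}) a b :
  subchar a b -> subchar ('Ind[H] a) ('Ind[H] b).
Proof. by move=> [ca cba]; split; rewrite -?raddfB cfInd_char. Qed.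

Lemma subchar_Res (H : {group gT}) a b :
  subchar a b -> subchar ('Res[H] a) ('Res[H] b).
Proof. by move=> [ca cba]; split; rewrite -?raddfB cfRes_char. Qed.

End SubChar.

Lemma subchar_Morph (aT rT : finGroupType) (D G : {group aT}) (f : {morphism D >-> rT})
    (a b : 'CF((f @* G)%g)) : subchar a b -> subchar (cfMorph a) (cfMorph b).
Proof. by move=> [ca cba]; split; rewrite -?raddfB cfMorph_char. Qed.

Lemma subchar_Dprod (gT : finGroupType) (G K H : {group gT}) (KxH : (K \x H)%g = G)
    (a b : 'CF(K)) (a' b' : 'CF(H)) :
  subchar a b -> subchar a' b' -> subchar (cfDprod KxH a a') (cfDprod KxH b b').
Proof.
move=> [ca cba] sa'; have cb' := subchar_char sa'; case: sa' => ca' cba'.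
split; first exact: cfDprod_char.
have -> : cfDprod KxH b b' - cfDprod KxH a a' =
          cfDprod KxH (b - a) b' + cfDprod KxH a (b' - a').
  by rewrite /cfDprod !raddfB /= mulrBl mulrBr addrA subrK.
by rewrite rpredD // cfDprod_char.
Qed.

Lemma sign_charE (gT : finGroupType) (G : {group gT}) (f : gT -> bool)
    (fM : {in G &, {morph f : x y / (x * y)%g >-> x (+) y}}) s :
  sign_char fM s = (-1) ^+ f s *+ (s \in G).
Proof. by rewrite /sign_char cfunElock. Qed.

Lemma sign_char_lin (gT : finGroupType) (G : {group gT}) (f : gT -> bool)
    (fM : {in G &, {morph f : x y / (x * y)%g >-> x (+) y}}) :
  sign_char fM \is a linear_char.
Proof.
have f1 : f 1%g = false.
  by have := fM _ _ (group1 G) (group1 G); rewrite mulg1; case: (f 1%g).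
have rP : mx_repr G (fun s => ((-1) ^+ f s)%:M : 'M[algC]_1).
  split=> [|s t Gs Gt]; first by rewrite f1.
  by rewrite fM // signr_addb scalar_mxM.
suff -> : sign_char fM = cfRepr (MxRepresentation rP).
  by apply/andP; rewrite cfRepr_char cfRepr1.
apply/cfun_inP => s Gs; rewrite sign_charE cfunElock Gs /= mxtrace_scalar.
by rewrite !mulr1n.
Qed.

Section Mackey.
Variables (gT : finGroupType) (G D K K' : {group gT}).
Hypotheses (sKG : K \subset G) (sK'G : K' \subset G) (sDG : D \subset G).
Variables (th : 'CF(K)) (th' : 'CF(K')).
Hypotheses (lth : th \is a linear_char) (lth' : th' \is a linear_char).

(** Since class functions vanish off their group, this is, up to a group order, the scalar product
    of two conjugated linear characters on the subgroup of [D] where both live. *)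
Definition mackey_term k l := \sum_(g in D) th (g ^ k)%g * (th' (g ^ l)%g)^*.

Lemma mackey_sum : '['Res[D] ('Ind[G] th), 'Res[D] ('Ind[G] th')] =
  (#|D|%:R^-1 * #|K|%:R^-1 * #|K'|%:R^-1) *
    \sum_(k in G) \sum_(l in G) mackey_term k l.
Proof.
rewrite cfdotE -!mulrA; congr (_ * _).
transitivity (\sum_(g in D) #|K|%:R^-1 * (#|K'|%:R^-1 *
   \sum_(k in G) \sum_(l in G) th (g ^ k)%g * (th' (g ^ l)%g)^*)).
  apply: eq_bigr => g Dg; rewrite !cfResE // !cfIndE // rmorphM fmorphV rmorph_nat.
  rewrite -mulrA; congr (_ * _); rewrite mulrCA; congr (_ * _).
  rewrite rmorph_sum big_distrl; apply: eq_bigr => k _ /=.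
  by rewrite big_distrr.
rewrite -big_distrr -big_distrr /=; do 2 congr (_ * _).
rewrite exchange_big; apply: eq_bigr => k _ /=.
by rewrite exchange_big.
Qed.

(** The element [x] may lie outside [H]: then so does the product, and both sides vanish. *)
Lemma lin_charMr (H : {group gT}) (xi : 'CF(H)) x y :
  xi \is a linear_char -> y \in H -> xi (x * y)%g = xi x * xi y.
Proof.
move=> lxi Hy; case: (boolP (x \in H)) => Hx; first exact: lin_charM.
by rewrite [xi x]cfun0 // mul0r cfun0 // groupMr.
Qed.

(** Translating the summation variable by [t] multiplies the term by [th (t ^ k)] times the
    conjugate of [th' (t ^ l)]. If the term is nonzero this factor is 1, and values of linear
    characters have modulus 1. *)
Lemma mackey_term_dichotomy k l :
  (forall t, t \in D -> (t ^ k)%g \in K -> (t ^ l)%g \in K' ->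
     th (t ^ k)%g = th' (t ^ l)%g) \/ mackey_term k l = 0.
Proof.
case: (eqVneq (mackey_term k l) 0) => [|nz]; [by right | left=> t Dt Kt K't].
have : mackey_term k l * (th (t ^ k)%g * (th' (t ^ l)%g)^*) = mackey_term k l.
  rewrite {2}/mackey_term (reindex_inj (mulIg t)) /= big_distrl.
  apply: eq_big => [g|g _]; first by rewrite groupMr.
  rewrite /= !conjMg (lin_charMr _ lth Kt) (lin_charMr _ lth' K't) rmorphM.
  exact: mulrACA.
move/(canRL (mulKf nz)); rewrite mulVf // => e1.
have := normC_lin_char lth' K't => n1.
have : th (t ^ k)%g * (th' (t ^ l)%g)^* * th' (t ^ l)%g = th' (t ^ l)%g.
  by rewrite e1 mul1r.
by rewrite -mulrA [_^* * _]mulrC -normCK n1 expr1n mulr1.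
Qed.

Lemma mackey_neq0 : '['Res[D] ('Ind[G] th), 'Res[D] ('Ind[G] th')] != 0 ->
  exists k l, [/\ k \in G, l \in G & forall t, t \in D -> (t ^ k)%g \in K ->
     (t ^ l)%g \in K' -> th (t ^ k)%g = th' (t ^ l)%g].
Proof.
rewrite mackey_sum => nz.
suff /existsP[k /existsP[l /and3P[Gk Gl tn]]] :
  [exists k, exists l, [&& k \in G, l \in G & mackey_term k l != 0]].
  exists k, l; split=> //; case: (mackey_term_dichotomy k l) => // e.
  by rewrite e eqxx in tn.
apply: contraR nz => /existsPn nz; rewrite big1 ?mulr0 // => k Gk.
rewrite big1 // => l Gl; apply/eqP; apply: contraT => tn.
by have /existsPn/(_ l) := nz k; rewrite Gk Gl tn.
Qed.

End Mackey.

(** With [D = G] every Mackey term is nonnegative, and the one at [k = l = 1] equals 1 because only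
    [g = 1] contributes. *)
Lemma mackey_trivI (gT : finGroupType) (G K K' : {group gT}) (th : 'CF(K)) (th' : 'CF(K')) :
  K \subset G -> K' \subset G -> th \is a linear_char -> th' \is a linear_char ->
  K :&: K' = 1%g -> '['Ind[G] th, 'Ind[G] th'] != 0.
Proof.
move=> sKG sK'G lth lth' tI.
rewrite -['Ind th]cfRes_id -['Ind th']cfRes_id mackey_sum //.
have ge0 k l : 0 <= mackey_term G th th' k l.
  case: (mackey_term_dichotomy G lth lth' k l) => [H|->] //.
  apply: sumr_ge0 => t Gt; case: (boolP ((t ^ k)%g \in K)) => Kt; last first.
    by rewrite cfun0 ?mul0r.
  case: (boolP ((t ^ l)%g \in K')) => K't; last by rewrite [th' _]cfun0 ?rmorph0 ?mulr0.
  by rewrite H // mul_conjC_ge0.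
rewrite !mulf_neq0 ?invr_eq0 ?pnatr_eq0 -?lt0n ?cardG_gt0 //.
rewrite gt_eqF // (bigD1 1%g) //= (bigD1 1%g) //= -addrA ltr_pwDl //.
  rewrite /mackey_term (bigD1 1%g) //= big1 ?addr0.
    by rewrite !conj1g !lin_char1 // rmorph1 mulr1 ltr01.
  move=> g /andP[_ g1]; rewrite !conjg1; case: (boolP (g \in K)) => Kg.
    rewrite [th' _]cfun0 ?rmorph0 ?mulr0 //; apply: contra g1 => K'g.
    have : g \in K :&: K' by rewrite inE Kg.
    by rewrite tI inE.
  by rewrite cfun0 ?mul0r.
by rewrite addr_ge0 // ?sumr_ge0 // => k _; rewrite sumr_ge0.
Qed.

(** Conjugation in [H] acts on each factor separately, so the sum over [H] splits. If a component
    falls outside [K1] or [K2], uniqueness of the decomposition in [H] keeps the product outside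
    [K], and both sides vanish. *)
Lemma cfDprod_Ind (gT : finGroupType) (H1 H2 H K1 K2 K : {group gT})
    (H12 : (H1 \x H2)%g = H) (K12 : (K1 \x K2)%g = K) (phi1 : 'CF(K1)) (phi2 : 'CF(K2)) :
  K1 \subset H1 -> K2 \subset H2 ->
  cfDprod H12 ('Ind[H1] phi1) ('Ind[H2] phi2) = 'Ind[H] (cfDprod K12 phi1 phi2).
Proof.
move=> s1 s2; have [_ eH cH tH] := dprodP H12; have [_ eK cK tK] := dprodP K12.
have sKH : K \subset H by rewrite -eH -eK mulgSS.
apply/cfun_inP => h; rewrite -{1}eH => /mulsgP[x y H1x H2y ->].
rewrite cfDprodE // !cfIndE // (reindex_dprod H12) /= -(dprod_card K12) natrM invfM.
rewrite mulrACA; congr (_ * _); rewrite big_distrl; apply: eq_bigr => u H1u /=.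
rewrite big_distrr; apply: eq_bigr => v H2v /=.
have com a b : a \in H1 -> b \in H2 -> commute a b.
  by move=> ? ?; apply/commute_sym; apply: (centsP cH).
have -> : ((x * y) ^ (u * v) = x ^ u * y ^ v)%g.
  rewrite conjMg; congr (_ * _)%g; rewrite conjgM.
    by rewrite conjgE (com _ v) ?groupJ // mulKg.
  by rewrite [(y ^ u)%g]conjgE -(com u y) // mulKg.
have H1xu := groupJ H1x H1u; have H2yv := groupJ H2y H2v.
case: (boolP ((x ^ u)%g \in K1)) => K1x; last first.
  rewrite cfun0 // mul0r cfun0 //; apply: contra K1x; rewrite -eK => /mulsgP[a b K1a K2b e].
  suff -> : (x ^ u)%g = a by [].
  have e1 : (a^-1 * x ^ u = b * (y ^ v)^-1)%g.
    by apply: (canRL (mulgK (y ^ v)%g)); rewrite -mulgA e mulKg.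
  have : (a^-1 * x ^ u)%g \in H1 :&: H2.
    have H1a := subsetP s1 _ K1a; have H2b := subsetP s2 _ K2b.
    by rewrite inE {2}e1 !groupM ?groupV.
  by rewrite tH inE -eq_invg_mul invgK => /eqP.
case: (boolP ((y ^ v)%g \in K2)) => K2y; last first.
  rewrite [phi2 _]cfun0 // mulr0 cfun0 //; apply: contra K2y => Kxy.
  have : ((x ^ u)^-1 * (x ^ u * y ^ v))%g \in K.
    by rewrite groupM // groupV -eK (subsetP (mulG_subl _ _)).
  rewrite mulKg -eK => /mulsgP[a b K1a K2b e].
  suff a1 : a = 1%g by rewrite e a1 mul1g.
  have e1 : a = (y ^ v * b^-1)%g by rewrite e mulgK.
  have : a \in H1 :&: H2.
    have H1a := subsetP s1 _ K1a; have H2b := subsetP s2 _ K2b.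
    by rewrite inE {2}e1 groupM ?groupV ?H1a.
  by rewrite tH inE => /eqP.
by rewrite cfDprodE.
Qed.

(** Inflation commutes with induction because [K], the full preimage of [R] in [G], contains the
    kernel of [f] on [G]. *)
Lemma cfInd_inflate (aT rT : finGroupType) (D G K : {group aT}) (f : {morphism D >-> rT})
    (S R : {group rT}) (phi : 'CF(R)) (th : 'CF(K)) g :
  G \subset D -> K = (G :&: (f @*^-1 R)%g)%G -> (f @* G)%g = S -> R \subset S ->
  {in K, forall x, th x = phi (f x)} -> g \in G ->
  'Ind[G] th g = 'Ind[S] phi (f g).
Proof.
move=> sGD eK eS sRS eth Gg.
have sKG : K \subset G by rewrite eK subsetIl.
pose f' := restrm_morphism sGD f.
have eG : (f' @* G)%g = S :> {set _} by rewrite restrmEsub.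
have eR : (f' @* K)%g = R :> {set _}.
  rewrite restrmEsub // eK /= morphimIG ?ker_sub_pre //.
  rewrite eS morphpreK ?(setIidPr sRS) //.
  by apply: subset_trans sRS _; rewrite -eS morphimS.
have eth' : th = cfMorph (f := f') ('Res[(f' @* K)%g] phi).
  apply/cfun_inP => x Kx; rewrite cfMorphE // eth // cfResE ?eR //.
  by rewrite -eR mem_morphim // (subsetP sKG).
rewrite eth' cfIndMorph //; last first.
  by rewrite ker_restrm eK /= setIS // ker_sub_pre.
rewrite cfMorphE // !cfIndE ?morphimS //; congr (_ * _).
  by rewrite /= eR.
rewrite (eq_bigl _ _ (fun y => congr1 (fun A : {set _} => y \in A) eG)).
apply: eq_bigr => y Sy; case: (boolP ((f' g ^ y)%g \in (f' @* K)%g)) => fK.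
  by have sR : (f' @* K)%g \subset R; [rewrite eR | rewrite (cfResE _ sR)].
by rewrite !cfun0 // -eR.
Qed.

End Characters.

(** * Dominance order *)

Lemma reshape_index_lt sh i m :
  i < sumn sh -> (reshape_index sh i < m) = (i < sumn (take m sh)).
Proof.
rewrite /reshape_index; elim: sh m i => //= a sh IHsh [|m] i; first by rewrite ltn0.
rewrite subn_eq0; have [lt|le] := ltnP i a; first by move=> _; rewrite ltn_addr.
by rewrite subSn // => lt; rewrite ltnS IHsh ltn_subLR.
Qed.

Section Cells.
Variables (T : finType) (A : {set T}) (lam : seq nat).
Hypothesis (cA : #|A| = sumn lam).

Lemma index_cell x : x \in A -> index x (enum A) < sumn lam.
Proof. by move=> Ax; rewrite -cA cardE index_mem mem_enum. Qed.

Lemma cell_inj x y : x \in A ->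
  cell_row A lam x = cell_row A lam y -> cell_col A lam x = cell_col A lam y -> x = y.
Proof.
move=> Ax er ec; have e : index x (enum A) = index y (enum A).
  by rewrite -[LHS](reshape_indexK lam) -[RHS](reshape_indexK lam); congr flatten_index.
have yA : y \in enum A by rewrite -index_mem -e index_mem mem_enum.
by rewrite -[LHS](nth_index x (s := enum A)) ?mem_enum // e nth_index.
Qed.

Lemma card_rows_lt m : #|[set x in A | cell_row A lam x < m]| = sumn (take m lam).
Proof.
have le : sumn (take m lam) <= size (enum A).
  by rewrite -cardE cA -{2}(cat_take_drop m lam) sumn_cat leq_addr.
rewrite -(size_takel le) -(card_uniqP _) ?take_uniq ?enum_uniq //.
apply: eq_card => x; rewrite !inE; case: (boolP (x \in A)) => [Ax | nAx] /=.
  by rewrite in_take ?mem_enum // reshape_index_lt // index_cell.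
by apply/esym/negP => /mem_take; rewrite mem_enum (negPf nAx).
Qed.

Hypothesis (slam : sorted geq lam).

(** Row lengths of a partition weakly decrease, so a column that meets a row meets all earlier
    rows. *)
Lemma cell_above x r : x \in A -> r < cell_row A lam x ->
  exists2 y, y \in A & cell_row A lam y = r /\ cell_col A lam y = cell_col A lam x.
Proof.
move=> Ax ltr; have lti := index_cell Ax.
have ltc : cell_col A lam x < nth 0 lam r.
  apply: leq_trans (reshape_offsetP lti) _.
  have szx : cell_row A lam x < size lam by apply: reshape_indexP.
  have h := @sorted_leq_nth _ geq (rev_trans leq_trans) leqnn 0 lam slam r (cell_row A lam x).
  exact: h (ltn_trans ltr szx) szx (ltnW ltr).
set j := flatten_index lam r (cell_col A lam x).
have ltj : j < index x (enum A).
  rewrite ltnNge [_ <= j](reshape_leq lam) /j flatten_indexKl // flatten_indexKr //.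
  by rewrite -/(cell_row A lam x) ltnNge (ltnW ltr) /= eq_sym ltn_eqF.
have ltjs : j < size (enum A) by apply: ltn_trans ltj _; rewrite index_mem mem_enum.
have ej : index (nth x (enum A) j) (enum A) = j by rewrite index_uniq ?enum_uniq.
exists (nth x (enum A) j); first by rewrite -mem_enum mem_nth.
rewrite /cell_row {1}/cell_col ej.
by split; [apply: flatten_indexKl | apply: flatten_indexKr].
Qed.

End Cells.

Definition dominated (lam mu : seq nat) :=
  forall m, sumn (take m lam) <= sumn (take m mu).

(** Equality is stated entry by entry because the lists may differ by trailing zeros. *)
Lemma dominated_antisym lam mu : dominated lam mu -> dominated mu lam ->
  forall i, nth 0 lam i = nth 0 mu i.
Proof.
move=> d1 d2; have e m : sumn (take m lam) = sumn (take m mu).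
  by apply/anti_leq; rewrite d1 d2.
have st (s : seq nat) i : sumn (take i.+1 s) = sumn (take i s) + nth 0 s i.
  elim: s i => [|a s IHs] [|i] //=; first by rewrite take0 addn0.
  by rewrite IHs addnA.
by move=> i; have := e i.+1; rewrite !st e => /addnI.
Qed.

Lemma dominated_trans lam mu nu : dominated lam mu -> dominated mu nu -> dominated lam nu.
Proof. by move=> d1 d2 m; apply: leq_trans (d1 m) (d2 m). Qed.

Lemma leq_card_fibers (T : finType) (U V : {set T}) (h : T -> nat) :
  (forall c, #|[set x in U | h x == c]| <= #|[set x in V | h x == c]|) -> #|U| <= #|V|.
Proof.
move=> H; pose N := \max_x h x; pose p x : 'I_N.+1 := inord (h x).
have ph x c : (p x == c) = (h x == c).
  rewrite -val_eqE /= inordK // ltnS; exact: leq_bigmax.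
have E (W : {set T}) : #|W| = \sum_(c : 'I_N.+1) #|[set x in W | h x == c]|.
  rewrite -sum1_card (partition_big p predT) //=; apply: eq_bigr => c _.
  by rewrite sum1dep_card; apply: eq_card => x; rewrite !inE ph.
by rewrite !E; apply: leq_sum => c _; apply: H.
Qed.

(* Elements of the first m rows of lam lie in distinct rows within each column
   of mu, so such a column holds at most m of them and they can be pushed up
   into its first m cells. *)
Lemma dominance (T : finType) (A B : {set T}) (lam mu : seq nat) (p q : {perm T}) :
  #|A| = sumn lam -> #|B| = sumn mu -> sorted geq mu ->
  (forall i, (p i \in A) = (q i \in B)) ->
  (forall i j, i != j -> p i \in A -> p j \in A ->
     cell_row A lam (p i) = cell_row A lam (p j) ->
     cell_col B mu (q i) <> cell_col B mu (q j)) ->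
  dominated lam mu.
Proof.
move=> cA cB smu pq H m.
rewrite -(card_rows_lt cA) -(card_rows_lt cB).
rewrite -(card_preimset _ (@perm_inj _ p)) -(card_preimset [set x in B | _] (@perm_inj _ q)).
apply: (@leq_card_fibers _ _ _ (fun i => cell_col B mu (q i))) => c.
(* If column [c] of [mu] goes beyond its first [m] rows, it has a cell in each of these, so the
   right fibre has at least [m] elements; the left one has at most one per row of [lam], hence at
   most [m]. Otherwise the right fibre is the whole column. *)
case: (boolP [exists i, [&& q i \in B, cell_col B mu (q i) == c & m <= cell_row B mu (q i)]]).
  case/existsP => i0 /and3P[Bi0 /eqP ec lem]; apply: (@leq_trans m).
    rewrite -[X in _ <= X]card_ord.
    (* The map to row numbers uses [inord], whose target must be nonempty. *)
    have [m0|m0] := posnP m.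
      rewrite (_ : finset _ = finset.set0) ?cards0 //.
      by apply/setP => i; rewrite !inE m0 ltn0 andbF.
    case: m m0 lem => // m _ lem.
    apply: (@leq_card_in _ _ (fun i => inord (cell_row A lam (p i)) : 'I_m.+1)) => i j.
    rewrite !inE => /andP[/andP[Ai lti] /eqP ci] /andP[/andP[Aj ltj] /eqP cj] /(congr1 val).
    rewrite /= !inordK // => er; apply/eqP; apply: contraT => ne.
    by case: (H i j ne Ai Aj er); rewrite ci cj.
  have rowex (r : 'I_m) : {i | [&& q i \in B, cell_row B mu (q i) == r & cell_col B mu (q i) == c]}.
    apply: sigW; have [y By [e1 e2]] := cell_above cB smu Bi0 (leq_trans (ltn_ord r) lem).
    by exists (q^-1%g y); rewrite permKV By e1 e2 ec !eqxx.
  rewrite -[X in X <= _]card_ord.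
  rewrite -[X in X <= _](card_imset _ (_ : injective (fun r => sval (rowex r)))); last first.
    move=> r s e; apply/val_inj => /=.
    have /and3P[_ /eqP er _] := svalP (rowex r); have /and3P[_ /eqP es _] := svalP (rowex s).
    by rewrite -er -es e.
  apply/subset_leq_card/subsetP => _ /imsetP[r _ ->].
  by have /and3P[Bi /eqP er /eqP ecr] := svalP (rowex r); rewrite !inE Bi er ecr ltn_ord eqxx.
rewrite negb_exists => /forallP no; apply/subset_leq_card/subsetP => i.
rewrite !inE => /andP[/andP[Ai _] ci]; have := no i; rewrite -pq Ai ci /=.
by rewrite -ltnNge => ->.
Qed.

(** * Specht characters and signed permutations *)

Section Specht.
Local Open Scope ring_scope.
Variables (T : finType) (A : {set T}).

(** One boolean covers both sides: rows with the trivial character for [true], columns with the sign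
    for [false]. *)
Definition cell_fun (rw : bool) := if rw then @cell_row T A else @cell_col T A.

Lemma side_signM rw (G : {group {perm T}}) :
  {in G &, {morph (fun s : {perm T} => ~~ rw && odd_perm s) : s t / (s * t)%g >-> s (+) t}}.
Proof. by move=> s t _ _; rewrite odd_permM; case: rw. Qed.

Definition side_char rw lam := sign_char (@side_signM rw (stab_group A (cell_fun rw lam))).

Lemma stab_sub f : stab A f \subset perm.Sym A.
Proof. by apply/subsetP => s; rewrite inE => /andP[]. Qed.

(** A cell is determined by its row and column, so the two stabilizers meet trivially and the
    induced characters are not orthogonal. Hence the [pick] in [specht] succeeds and returns a
    constituent of both. *)
Lemma specht_subchar rw lam : subchar (specht A lam) ('Ind[perm.Sym A] (side_char rw lam)).
Proof.
set R := stab_group A (cell_row A lam); set C := stab_group A (cell_col A lam).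
have eR : side_char true lam = 1 :> 'CF(R).
  by apply/cfun_inP => s Rs; rewrite sign_charE cfun1E Rs.
have eC : side_char false lam = sign_char (@odd_permM_in _ C).
  by apply/cfunP => s; rewrite !sign_charE.
have nz : '['Ind[perm.Sym A] (1 : 'CF(R)), 'Ind[perm.Sym A] (side_char false lam)] != 0.
  rewrite -eR; apply: mackey_trivI; rewrite ?stab_sub ?sign_char_lin //.
  apply/trivgP/subsetP => s; rewrite !inE => /andP[/andP[As /forallP sr] /andP[_ /forallP sc]].
  apply/eqP/permP => x; rewrite perm1; case: (boolP (x \in A)) => Ax.
    by apply: (@cell_inj _ A lam); rewrite ?(perm_closed _ As) //; [exact/eqP/sr | exact/eqP/sc].
  exact: out_perm As Ax.
rewrite /specht; case: pickP => [i /andP[iR iC]|no].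
  have sub (b : 'CF(perm.Sym A)) : b \is a character -> i \in irr_constt b -> subchar 'chi_i b.
    move=> cb /(constt_charP _ cb)[b' cb' ->]; split; first exact: irr_char.
    by rewrite addrC addKr.
  by case: rw; apply: sub; rewrite ?cfInd_char ?(lin_charW (sign_char_lin _)) //= ?eR ?eC.
case/eqP: nz; rewrite cfdot_sum_irr big1 // => i _; have := no i.
rewrite !irr_consttE -eC; case: eqP => [-> _|_ /=]; first by rewrite mul0r.
by move/negbFE/eqP->; rewrite rmorph0 mulr0.
Qed.

End Specht.

Section Signed.
Local Open Scope group_scope.
Variable n : nat.
Implicit Types (s t k l : {perm 'I_n * bool}) (A X Y : {set 'I_n}).

Lemma WBonP X s :
  reflect (s \in WB n /\ forall x, s x != x -> x.1 \in X) (s \in WBon X).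
Proof.
have -> : (s \in WBon X) = (s \in WB n) && perm_on (finset.setX X [set: bool]) s.
  by rewrite [LHS]inE [in X in _ && X]inE.
apply: (iffP andP) => -[Ws H]; split=> //.
  by move=> [i b] ne; have := subsetP H (i, b) ne; rewrite !inE andbT.
by apply/subsetP => -[i b] /H Xi; rewrite !inE andbT.
Qed.

Lemma WBon_sub X : WBon X \subset WB n.
Proof. exact: subsetIl. Qed.

Lemma WBonJ X Y s k : s \in WBon Y -> k \in WB n ->
  (forall i, i \in Y -> absp k i \in X) -> s ^ k \in WBon X.
Proof.
move=> /WBonP[Ws mY] Wk H; apply/WBonP; split; first by rewrite groupJ.
move=> x; rewrite -[x](permKV k) permJ (inj_eq perm_inj) => /mY/H.
rewrite abspE //; set y := k^-1 x; case: y => i b /=.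
by have /WBP cs := Wk; rewrite (cs i b).
Qed.

Lemma absp_WBon X : @absp n @: WBon X = perm.Sym X.
Proof.
apply/setP => u; apply/imsetP/idP => [[s /WBonP[Ws mX] ->]|].
  rewrite inE; apply/subsetP => i; rewrite !inE abspE // => ne.
  by apply: (mX (i, false)); apply: contra ne => /eqP->.
rewrite inE => uX.
have inj : injective (fun x : 'I_n * bool => (u x.1, x.2)).
  by move=> [i a] [j b] [/perm_inj-> ->].
have Ws : perm inj \in WB n by apply/WBP => i b; rewrite !permE.
exists (perm inj); last by apply/permP => i; rewrite abspE // permE.
apply/WBonP; split=> // -[i b]; rewrite permE /= => ne.
by apply: contraR ne => Xi; rewrite (out_perm uX Xi).
Qed.

Lemma morphim_absp X : @absp n @* WBon X = perm.Sym X.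
Proof. by rewrite morphimEsub ?WBon_sub // absp_WBon. Qed.

Definition flip_fun (i : 'I_n) (x : 'I_n * bool) := (x.1, x.2 (+) (x.1 == i)).

Lemma flip_inj i : injective (flip_fun i).
Proof. by move=> [j a] [k b] [<- /addIb ->]. Qed.

Definition flip i := perm (@flip_inj i).

Lemma flip_WBon i : flip i \in WBon [set i].
Proof.
apply/WBonP; split; first by apply/WBP => j b; rewrite !permE /flip_fun /= addbC.
move=> [j b]; rewrite permE /flip_fun /= inE; apply: contraR => /negPf->.
by rewrite addbF.
Qed.

Lemma absp_flip i : absp (flip i) = 1.
Proof.
apply/permP => j; have /WBonP[W _] := flip_WBon i.
by rewrite abspE // permE perm1.
Qed.

Lemma sign_changes_flip i : sign_changes (flip i) = [set i].
Proof. by apply/setP => j; rewrite !inE permE. Qed.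

Definition swap_fun (i j : 'I_n) (x : 'I_n * bool) := (tperm i j x.1, x.2).

Lemma swap_inj i j : injective (swap_fun i j).
Proof. by move=> [a b] [c d] [/perm_inj-> ->]. Qed.

Definition swap i j := perm (@swap_inj i j).

Lemma swap_WBon i j : swap i j \in WBon [set i; j].
Proof.
apply/WBonP; split; first by apply/WBP => a b; rewrite !permE.
move=> [a b]; rewrite permE /swap_fun /= !inE; apply: contraR.
by rewrite negb_or => /andP[ai aj]; rewrite tpermD // eq_sym.
Qed.

Lemma absp_swap i j : absp (swap i j) = tperm i j.
Proof.
apply/permP => a; have /WBonP[W _] := swap_WBon i j.
by rewrite abspE // permE.
Qed.

Lemma sign_changes_swap i j : sign_changes (swap i j) = finset.set0.
Proof. by apply/setP => a; rewrite !inE permE. Qed.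

Section Side.
Variables (rw : bool) (X : {set 'I_n}) (lam : seq nat).

Definition sideK : {group {perm 'I_n * bool}} :=
  (WBon X :&: @absp n @*^-1 stab_group X (cell_fun X rw lam))%G.

Definition sideT : 'CF(sideK) :=
  cfMorph ('Res[@absp n @* sideK] (side_char X rw lam))%R.

Lemma sideK_sub : sideK \subset WBon X.
Proof. exact: subsetIl. Qed.

Lemma sideK_WB : sideK \subset WB n.
Proof. exact: subset_trans sideK_sub (WBon_sub _). Qed.

Lemma sideK_stab : @absp n @* sideK \subset stab_group X (cell_fun X rw lam).
Proof.
by rewrite sub_morphim_pre ?sideK_WB // subsetIr.
Qed.

Lemma sideT_lin : sideT \is a linear_char.
Proof. by rewrite cfMorph_lin_char // cfRes_lin_char // sign_char_lin. Qed.

Lemma sideTE s : s \in sideK -> sideT s = ((-1) ^+ (~~ rw && odd_perm (absp s)))%R.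
Proof.
move=> Ks; have Ws := subsetP sideK_WB _ Ks.
have Ka := mem_morphim (absp_morphism n) Ws Ks.
rewrite /sideT cfMorphE ?sideK_WB // cfResE ?sideK_stab // sign_charE.
by rewrite (subsetP sideK_stab).
Qed.

(** Inflating the containment for Specht characters suffices, since [sideK] is the full preimage of
    the stabilizer. *)
Lemma inflated_subchar : subchar (inflated X lam) ('Ind[WBon X] sideT)%R.
Proof.
have -> : ('Ind[WBon X] sideT)%R = cfMorph ('Res[@absp n @* WBon X] ('Ind[perm.Sym X] (side_char X rw lam)))%R.
  apply/cfun_inP => s Xs; rewrite cfMorphE ?WBon_sub // cfResE ?morphim_absp //.
    apply: (cfInd_inflate (f := absp_morphism n)) Xs; rewrite ?WBon_sub ?stab_sub //.
      exact: morphim_absp.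
    move=> t Kt; rewrite sideTE // sign_charE.
    by rewrite (subsetP sideK_stab) // mem_morphim // (subsetP sideK_WB).
  by rewrite -morphim_absp mem_morphim // (subsetP (WBon_sub X)).
exact/subchar_Morph/subchar_Res/specht_subchar.
Qed.

Lemma sideKP s : s \in WBon X ->
  (forall i, i \in X -> cell_fun X rw lam (absp s i) = cell_fun X rw lam i) -> s \in sideK.
Proof.
move=> Xs H; have Ws := subsetP (WBon_sub X) _ Xs; rewrite inE Xs /=.
have Sa : absp s \in perm.Sym X by rewrite -morphim_absp mem_morphim.
apply/morphpreP; split=> //; rewrite inE Sa /=; apply/forallP => i.
case: (boolP (i \in X)) => [/H->//|Xi]; move: Sa; rewrite inE => Sa.
by rewrite (out_perm Sa Xi).
Qed.

End Side.

End Signed.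

(** * Orthogonality *)

Section Bipartition.
Local Open Scope group_scope.
Variable n : nat.

(** Index [false] stands for the first partition of the bipartition and [true] for the second, so
    that swapping them is adding a boolean to the index. *)
Definition block (lam : bool -> seq nat) (c : bool) : {set 'I_n} :=
  if c then ~: [set i : 'I_n | i < sumn (lam false)] else [set i : 'I_n | i < sumn (lam false)].

Lemma in_block lam c i : (i \in block lam c) = (i \in block lam false) (+) c.
Proof. by case: c; rewrite /block ?inE ?addbT ?addbF. Qed.

Lemma card_block lam c : sumn (lam false) + sumn (lam true) = n ->
  #|block lam c| = sumn (lam c).
Proof.
move=> e; have le : sumn (lam false) <= n by rewrite -e leq_addr.
have c0 : #|block lam false| = sumn (lam false).
  have inj : injective (widen_ord le) by move=> i j /(congr1 val) /= /val_inj.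
  rewrite -[RHS]card_ord -(card_imset _ inj).
  apply: eq_card => i; rewrite inE; apply/idP/imsetP => [lt|[j _ ->]]; last exact: ltn_ord j.
  by exists (Ordinal lt) => //; apply: val_inj.
case: c => //; have := cardsC (block lam false).
by rewrite c0 card_ord -/(block lam true); lia.
Qed.

Section SideChars.
Variables (rw : bool) (lam : bool -> seq nat).

Let K c := sideK rw (block lam c) (lam c).
Let T c := sideT rw (block lam c) (lam c).

Lemma biK_dprod : K false \x K true = K false <*> K true.
Proof.
have [_ _ cW tW] := dprodP (WBon_dprod (block lam false)).
apply: dprodEY.
  by apply: subset_trans (sideK_sub _ _ _) (subset_trans cW (centS (sideK_sub _ _ _))).
by apply/trivgP; rewrite -tW setISS // sideK_sub.
Qed.

Definition biK := (K false <*> K true)%G.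
Definition biT : 'CF(biK) :=
  cfDprod biK_dprod (T false) (T true * 'Res[K true] (chiB n))%R.

Lemma biK_sub : biK \subset (WBon (block lam false) <*> WBon (block lam true)).
Proof. by rewrite genS // setUSS // sideK_sub. Qed.

Lemma WBon_join X Y : WBon X <*> WBon Y \subset WB n.
Proof. by rewrite join_subG !WBon_sub. Qed.

Lemma biK_WB : biK \subset WB n.
Proof. exact: subset_trans biK_sub (WBon_join _ _). Qed.

Lemma chiB_lin : chiB n \is a linear_char.
Proof. exact: sign_char_lin. Qed.

Lemma biT_lin : biT \is a linear_char.
Proof.
rewrite cfDprod_lin_char ?sideT_lin // rpredM ?sideT_lin //.
by rewrite cfRes_lin_char // chiB_lin.
Qed.

(** Induction in stages passes through the product of the two blocks; there the external product of
    induced characters is induced, and the twist by [chiB] moves inside by the projection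
    formula. *)
Lemma bipartition_subchar :
  subchar ('Res[WD n] (bipartition_char n (lam false) (lam true)))%R
          ('Res[WD n] ('Ind[WB n] biT))%R.
Proof.
apply: subchar_Res; rewrite -(cfIndInd biT (WBon_join _ _) biK_sub).
rewrite /biT -(cfDprod_Ind (WBon_dprod (block lam false))) ?sideK_sub //.
apply/subchar_Ind/subchar_Dprod; first exact: inflated_subchar.
rewrite -(cfResRes _ (sideK_sub _ _ _) (WBon_sub _)) cfIndM ?sideK_sub //.
apply: subcharMr; last exact: inflated_subchar.
by rewrite cfRes_char ?lin_charW ?chiB_lin.
Qed.

Lemma biT_value c s : s \in WBon (block lam c) ->
  (forall i, i \in block lam c -> cell_fun (block lam c) rw (lam c) (absp s i) =
     cell_fun (block lam c) rw (lam c) i) ->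
  s \in biK /\ biT s = ((-1) ^+ (~~ rw && odd_perm (absp s)) * (chiB n s) ^+ c)%R.
Proof.
move=> Xs H; have Ks : s \in K c by apply: sideKP.
case: c Xs H Ks => Xs H Ks; rewrite ?expr1 ?expr0 ?mulr1.
  split; first by rewrite (subsetP (joing_subr _ _)).
  rewrite -[X in biT X]mul1g cfDprodE // (lin_char1 (sideT_lin _ _ _)) mul1r.
  by rewrite cfunE sideTE // cfResE ?sideK_WB.
split; first by rewrite (subsetP (joing_subl _ _)).
rewrite -[X in biT X]mulg1 cfDprodE // lin_char1 ?mulr1 ?sideTE //.
by rewrite rpredM ?sideT_lin // cfRes_lin_char // chiB_lin.
Qed.

End SideChars.

Lemma chiBE s : s \in WB n -> chiB n s = ((-1) ^+ odd #|sign_changes s|)%R.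
Proof. by move=> Ws; rewrite sign_charE Ws. Qed.

Lemma flip_WB (i : 'I_n) : flip i \in WB n.
Proof. by have /WBonP[] := flip_WBon i. Qed.

Lemma swap_WB (i j : 'I_n) : swap i j \in WB n.
Proof. by have /WBonP[] := swap_WBon i j. Qed.

(** A sign change has trivial underlying permutation, so all its conjugates preserve rows and
    columns; the value only tells the block of the letter. *)
Lemma biT_flip rw lam i k : k \in WB n ->
  flip i ^ k \in biK rw lam /\
  biT rw lam (flip i ^ k) = ((-1) ^+ (absp k i \notin block lam false))%R.
Proof.
move=> Wk; set c := absp k i \notin _.
have ab1 : absp (flip i ^ k) = 1.
  by rewrite (morphJ (absp_morphism n)) ?flip_WB //= absp_flip conj1g.
have [|j _|Kf ->] := @biT_value rw lam c (flip i ^ k).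
- apply: (WBonJ (flip_WBon i) Wk) => j /set1P->; rewrite in_block /c.
  by case: (_ \in _).
- by rewrite ab1 perm1.
split=> //; rewrite ab1 odd_perm1 andbF mul1r cfunJ // chiBE ?flip_WB //.
by rewrite sign_changes_flip cards1 expr1; case: c.
Qed.

Lemma biT_swap rw lam c i j k : k \in WB n -> i != j ->
  absp k i \in block lam c -> absp k j \in block lam c ->
  cell_fun (block lam c) rw (lam c) (absp k i) = cell_fun (block lam c) rw (lam c) (absp k j) ->
  swap i j ^ k \in biK rw lam /\ biT rw lam (swap i j ^ k) = ((-1) ^+ ~~ rw)%R.
Proof.
move=> Wk ne Xi Xj e.
have ab : absp (swap i j ^ k) = tperm (absp k i) (absp k j).
  by rewrite (morphJ (absp_morphism n)) ?swap_WB //= absp_swap tpermJ.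
have [|a _|Ks ->] := @biT_value rw lam c (swap i j ^ k).
- by apply: (WBonJ (swap_WBon i j) Wk) => a; rewrite !inE => /orP[] /eqP->.
- by rewrite ab; case: tpermP => // ->.
split=> //; rewrite ab odd_tperm (inj_eq perm_inj) ne andbT cfunJ // chiBE ?swap_WB //.
by rewrite sign_changes_swap cards0 expr1n mulr1.
Qed.

Lemma bi_dominated lam lam' :
  sumn (lam false) + sumn (lam true) = n -> sumn (lam' false) + sumn (lam' true) = n ->
  (forall c, sorted geq (lam' c)) ->
  ('['Res[WD n] ('Ind[WB n] (biT true lam)), 'Res[WD n] ('Ind[WB n] (biT false lam'))] != 0)%R ->
  exists e, forall c, dominated (lam c) (lam' (c (+) e)).
Proof.
move=> sl sl' so nz.
have sWD : WD n \subset WB n by apply/subsetP => s; rewrite inE => /andP[].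
have [k [l [Wk Wl H]]] :=
  mackey_neq0 (biK_WB _ _) (biK_WB _ _) sWD (biT_lin _ _) (biT_lin _ _) nz.
have [p ep] : {p | p = absp k} by exists (absp k).
have [q eq] : {q | q = absp l} by exists (absp l).
(* [d i] records whether [p i] and [q i] lie in blocks of different index; once constant, it is the
   swap [e]. *)
pose d i := (p i \in block lam false) (+) (q i \in block lam' false).
have dc i j : d i = d j.
  case: (eqVneq i j) => [->//|ne].
  have [Ki vi] := biT_flip true lam i Wk; have [Kj vj] := biT_flip true lam j Wk.
  have [Ki' vi'] := biT_flip false lam' i Wl; have [Kj' vj'] := biT_flip false lam' j Wl.
  (* A single sign change is outside W, but a product of two is inside and compares [d i] with
     [d j]. *)
  have tD : flip i * flip j \in WD n.
    rewrite inE groupM ?flip_WB //= odd_sign_changesM ?flip_WB //.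
    by rewrite !sign_changes_flip !cards1.
  have := H _ tD; rewrite !conjMg (groupM Ki Kj) (groupM Ki' Kj') => /(_ isT isT).
  rewrite (lin_charM (biT_lin _ _) Ki Kj) (lin_charM (biT_lin _ _) Ki' Kj') vi vj vi' vj' -!signr_addb -ep -eq.
  move=> /signr_inj; rewrite /d.
  by do 4 case: (_ \in _).
have [e de] : exists e, forall i, d i = e.
  exists [exists i, d i] => i; apply/idP/existsP => [di|[j]]; first by exists i.
  by rewrite (dc j i).
exists e => c.
apply: (@dominance _ (block lam c) (block lam' (c (+) e)) _ _ p q); rewrite ?card_block //.
  move=> i; rewrite in_block [RHS]in_block -(de i) /d.
  by do 2 case: (_ \in _); case: (c).
move=> i j ne Xi Xj er ec.
have X' a : p a \in block lam c -> q a \in block lam' (c (+) e).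
  rewrite [p a \in _]in_block [q a \in _]in_block -(de a) /d.
  by do 2 case: (_ \in _); case: (c).
(* The transposition of [i] and [j] would have value 1 on the row side and -1 on the column side,
   although the two characters agree on it. *)
have := @biT_swap true lam c i j k Wk ne; rewrite -ep => /(_ Xi Xj er)[K1 v1].
have := @biT_swap false lam' (c (+) e) i j l Wl ne.
rewrite -eq => /(_ (X' i Xi) (X' j Xj) ec)[K2 v2].
have := H (swap i j); rewrite K1 K2 v1 v2 inE swap_WB sign_changes_swap cards0.
by move=> /(_ isT isT isT)/signr_inj.
Qed.

Lemma bipartition_orth lam lam' :
  sumn (lam false) + sumn (lam true) = n -> sumn (lam' false) + sumn (lam' true) = n ->
  (forall c, sorted geq (lam c)) -> (forall c, sorted geq (lam' c)) ->
  ('['Res[WD n] (bipartition_char n (lam false) (lam true)),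
     'Res[WD n] (bipartition_char n (lam' false) (lam' true))] != 0)%R ->
  exists e, forall c i, nth 0 (lam c) i = nth 0 (lam' (c (+) e)) i.
Proof.
move=> sl sl' so so' nz.
have H rw rw' : ('['Res[WD n] ('Ind[WB n] (biT rw lam)),
     'Res[WD n] ('Ind[WB n] (biT rw' lam'))] != 0)%R.
  apply: contra nz => /eqP z; apply/eqP.
  by apply: subchar_cfdot z; apply: bipartition_subchar.
have [e de] := bi_dominated sl sl' so' (H true false).
have [|e' de'] := bi_dominated sl' sl so.
  by rewrite cfdotC fmorph_eq0 H.
exists e => c; apply: dominated_antisym; first exact: de.
(* The swaps [e] and [e'] may differ, so one round trip may end at the other partition; a second
   round trip returns to [c]. *)
have := de' (c (+) e); set c1 := _ (+) e' => d1.
have d2 := de c1; have d3 := de' (c1 (+) e).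
have ec : c1 (+) e (+) e' = c by rewrite /c1; case: (c); case: (e); case: (e').
rewrite ec in d3.
exact: dominated_trans d1 (dominated_trans d2 d3).
Qed.

End Bipartition.

(** * Partitions attached to the rows of a symbol *)

Lemma nth_parts r i : i < size r ->
  nth 0 (parts r) i = nth 0 r ((size r).-1 - i) - ((size r).-1 - i).
Proof.
move=> lt; have lt' : size r - i.+1 < size r by lia.
rewrite /parts nth_rev ?size_map ?size_iota // (nth_map 0) ?size_iota // nth_iota //.
by rewrite add0n (_ : size r - i.+1 = (size r).-1 - i) //; lia.
Qed.

Lemma size_parts r : size (parts r) = size r.
Proof. by rewrite size_rev size_map size_iota. Qed.

Lemma sorted_ltn_gap r i j : sorted ltn r -> i <= j -> j < size r ->
  nth 0 r i + (j - i) <= nth 0 r j.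
Proof.
move=> sr; elim: j => [|j IHj]; first by rewrite leqn0 => /eqP-> _; rewrite subnn addn0.
rewrite leq_eqVlt => /predU1P[-> _|lt ltj]; first by rewrite subnn addn0.
have := IHj lt (ltnW ltj).
have := @sorted_ltn_nth _ _ ltn_trans 0 _ sr j j.+1.
rewrite !inE => /(_ (ltnW ltj) ltj (leqnn _)) /=; lia.
Qed.

(** This makes the truncated subtraction in [parts] a genuine one. *)
Lemma sorted_ltn_ge r i : sorted ltn r -> i < size r -> i <= nth 0 r i.
Proof. by move=> sr lt; have := sorted_ltn_gap sr (leq0n i) lt; lia. Qed.

Lemma sorted_parts r : sorted ltn r -> sorted geq (parts r).
Proof.
move=> sr; apply/(sortedP 0) => i; rewrite size_parts => lt.
rewrite /= !nth_parts ?(ltnW lt) //.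
have := @sorted_ltn_gap r ((size r).-1 - i.+1) ((size r).-1 - i) sr; lia.
Qed.

Lemma sumn_parts r : sorted ltn r -> sumn (parts r) + \sum_(i < size r) i = sumn r.
Proof.
move=> sr; rewrite /parts sumn_rev sumnE big_map.
have -> : iota 0 (size r) = index_iota 0 (size r) by rewrite /index_iota subn0.
rewrite big_mkord sumnE (big_nth 0) big_mkord -big_split /=.
by apply: eq_bigr => i _; rewrite subnK // sorted_ltn_ge.
Qed.

Lemma parts_inj r r' : sorted ltn r -> sorted ltn r' -> size r = size r' ->
  (forall i, nth 0 (parts r) i = nth 0 (parts r') i) -> r = r'.
Proof.
move=> sr sr' es H; apply: (@eq_from_nth _ 0) => // i lti.
have := H ((size r).-1 - i); rewrite !nth_parts -?es; try lia.
have -> : (size r).-1 - ((size r).-1 - i) = i by lia.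
have := sorted_ltn_ge sr lti; rewrite es in lti; have := sorted_ltn_ge sr' lti; lia.
Qed.

Lemma size_rows L m : size L = m.*2 ->
  size (oddpos L) = m /\ size (evenpos L) = m.
Proof.
by move=> sL; rewrite oddposE evenposE !size_mkseq sL uphalf_double doubleK.
Qed.

Lemma double_sum_ord m : (\sum_(i < m) i).*2 = m * m.-1.
Proof.
elim: m => [|m IHm]; first by rewrite big_ord0.
by rewrite big_ord_recr /= doubleD IHm; case: m {IHm} => //= m; nia.
Qed.

(** Passing to partitions subtracts 0 + ... + (m-1) from each row, in total the [m ^ 2 - m] of the
    definition. *)
Lemma sum_parts_Sym' n L : Sym' n L ->
  sumn (parts (oddpos L)) + sumn (parts (evenpos L)) = n.
Proof.
move=> SL; have [m m1 [sL [sto ste] suL _ _]] := SL; have [so se] := size_rows sL.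
have := sumn_parts sto; have := sumn_parts ste; rewrite so se => e1 e2.
have := perm_sumn (perm_oddpos_evenpos L); rewrite sumn_cat suL -e1 -e2.
have := double_sum_ord m.
rewrite -mulnn; case: m {sL suL so se e1 e2} m1 => // m _ /=; nia.
Qed.

Lemma parts_head r : 0 < size r -> nth 0 (parts r) (size r).-1 = nth 0 r 0.
Proof. by move=> lt; rewrite nth_parts ?subnn ?subn0 ?prednK. Qed.

Lemma Erep_orth n L L' : Sym' n L -> Sym' n L' ->
  ('[Erep n L, Erep n L'] != 0)%R -> L = L'.
Proof.
pose lam L c := parts (if c then evenpos L else oddpos L).
move=> SL SL' nz.
have [m m1 [sL [sto ste] suL c0 [ns mx]]] := SL; have [so se] := size_rows sL.
have [m' m1' [sL' [sto' ste'] suL' c0' [ns' mx']]] := SL'.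
have [so' se'] := size_rows sL'.
have [e He] : exists e, forall c i, nth 0 (lam L c) i = nth 0 (lam L' (c (+) e)) i.
  apply: (bipartition_orth (n := n)) nz; try exact: sum_parts_Sym'.
    by case; apply: sorted_parts.
  by case; apply: sorted_parts.
(* If both partitions ended with a zero part, 0 would occur in both rows. This excludes different
   lengths: beyond the shorter symbol the default 0 would match the last parts of the longer one. *)
have zero M k : 0 < k -> size (oddpos M) = k -> size (evenpos M) = k ->
    sorted ltn (oddpos M) -> sorted ltn (evenpos M) -> count_mem 0 M <= 1 ->
    ~ (forall c, nth 0 (lam M c) k.-1 = 0).
  move=> k0 s1 s2 st1 st2 cM z; move: cM; rewrite count_rows //.
  have e1 : nth 0 (oddpos M) 0 = 0 by rewrite -parts_head ?s1 //; exact: z false.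
  have e2 : nth 0 (evenpos M) 0 = 0 by rewrite -parts_head ?s2 //; exact: z true.
  have o1 : 0 \in oddpos M by rewrite -{1}e1 mem_nth ?s1.
  have o2 : 0 \in evenpos M by rewrite -{1}e2 mem_nth ?s2.
  by rewrite o1 o2.
have sz M k c : size (oddpos M) = k -> size (evenpos M) = k -> size (lam M c) = k.
  by move=> s1 s2; rewrite size_parts; case: c.
have em : m = m'.
  case: (ltngtP m m') => // lt.
    case: (zero L' m' _ so' se' sto' ste' c0'); first by [].
    by move=> c; rewrite -[c](addbK e) -He nth_default // (sz L m) //; lia.
  case: (zero L m _ so se sto ste c0); first by [].
  by move=> c; rewrite He nth_default // (sz L' m') //; lia.
subst m'; case: e He => He; last first.
  rewrite -(interleaveK L) -(interleaveK L'); congr interleave.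
    by apply: parts_inj; rewrite ?so ?so' //; exact: (He false).
  by apply: parts_inj; rewrite ?se ?se' //; exact: (He true).
(* In the swapped case both symbols have the same entries appearing once, and the largest of them
   would lie in both rows of [L]. *)
have eo : oddpos L = evenpos L'.
  by apply: parts_inj; rewrite ?so ?se' //; exact: (He false).
have ee : evenpos L = oddpos L'.
  by apply: parts_inj; rewrite ?se ?so' //; exact: (He true).
have pL : perm_eq L L'.
  rewrite -(permPl (perm_oddpos_evenpos L)) -(permPr (perm_oddpos_evenpos L')).
  by rewrite eo ee perm_catC.
have ps : perm_eq (singles L) (singles L').
  rewrite /singles (eq_filter (a2 := once L')) ?perm_filter // => x.
  by rewrite /once (seq.permP pL).
move: mx mx'; rewrite -(perm_big _ ps) /= -eo max_singles // => m2 m3.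
have : last 0 (zs L) \in singles L.
  have : zs L != [::] by rewrite -size_eq0 size_sort size_eq0; apply/eqP.
  by rewrite -(mem_sort leq) -/(zs L); case: (zs L) => //= x s _; apply: mem_last.
by rewrite mem_singles // once_rows // m2 m3.
Qed.

From mathcomp Require Import boolp classical_sets functions cardinality fsbigop.

(** * The collections B and C *)

Section CollectionWords.
Local Open Scope classical_set_scope.

(** The word is T B T ... B T, whose second letter already steps from 1 to 0. *)
Lemma iota_word q : exists2 w, isword q.+1 w &
  seq_of w = iota 0 q.+1.*2.+1 /\ ~ nodrop w.
Proof.
pose s := iota 0 q.+1.*2.+1; pose w := mkseq (fun k => ~~ odd k) q.+1.*2.+1.
have st : posns true w = oddpos s.
  rewrite /posns /oddpos size_mkseq size_iota.
  rewrite -[LHS]map_id (_ : filter _ _ = [seq i <- iota 0 q.+1.*2.+1 | ~~ odd i]).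
    apply/eq_in_map => i; rewrite mem_filter mem_iota => /and3P[_ _ lti].
    by rewrite nth_iota.
  apply: eq_in_filter => i; rewrite mem_iota => /andP[_ lti].
  by rewrite nth_mkseq //; case: odd.
have sf : posns false w = evenpos s.
  rewrite /posns /evenpos size_mkseq size_iota.
  rewrite -[LHS]map_id (_ : filter _ _ = [seq i <- iota 0 q.+1.*2.+1 | odd i]).
    apply/eq_in_map => i; rewrite mem_filter mem_iota => /and3P[_ _ lti].
    by rewrite nth_iota.
  apply: eq_in_filter => i; rewrite mem_iota => /andP[_ lti].
  by rewrite nth_mkseq //; case: odd.
exists w; last first.
  split; first by rewrite /seq_of st sf interleaveK.
  by move=> /(_ [:: true]) /= H; have := H _ erefl.
rewrite /isword size_mkseq eqxx -size_posns st oddposE size_mkseq size_iota.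
by rewrite /= doubleK.
Qed.

Lemma Bcoll_word q Y b : Bcoll q Y -> Y b -> exists2 w, isword q w & b = seq_of w.
Proof.
elim: q Y b => [|q IHq] Y b.
  move=> -> [pb _ _]; exists [:: true] => //.
  by rewrite (perm_small_eq _ pb).
case=> [->|[i [Y' [lti BY' ->]]]].
  by move=> ->; have [w ww [<- _]] := iota_word q; exists w.
case=> -[b' /(IHq _ _ BY')[w ww ->] <-].
  exists (ins i true w); first exact: isword_ins.
  by rewrite (insert_pair_seq_of _ ww) //; rewrite doubleS in lti; lia.
exists (ins i false w); first exact: isword_ins.
by rewrite (insert_pair_seq_of _ ww) //; rewrite doubleS in lti; lia.
Qed.

Lemma nodrop_Ccoll q Y w :
  Bcoll q Y -> isword q w -> Y (seq_of w) -> nodrop w -> Ccoll q Y.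
Proof.
elim: q Y w => [|q IHq] Y w //=.
case=> [->|[i [Y' [lti BY' ->]]]] ww.
  have [w0 ww0 [/= <- nd]] := iota_word q.
  by move=> /(seq_of_inj ww ww0) ->.
(* Undoing the insertion leaves a word of [Y'] that is again [nodrop], so the induction hypothesis
   applies to [Y']. *)
have H c b' : Y' b' -> insert_pair i c b' = seq_of w -> nodrop w -> Ccoll q Y'.
  move=> Yb; have [w' ww' eb] := Bcoll_word BY' Yb; rewrite eb in Yb *.
  rewrite (insert_pair_seq_of _ ww'); last by rewrite doubleS in lti; lia.
  move=> /(seq_of_inj (isword_ins _ _ ww') ww) <- /nodrop_ins.
  exact: IHq Yb.
by case=> -[b' Yb' e] nd; exists i, Y'; split=> //; apply: H e nd.
Qed.

(** A noncrossing matching of all positions but one; the unmatched position carries T and no pair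
    encloses it. *)
Definition lang2 a b : set (seq bool) :=
  [set w | exists u v, [/\ lang a u, lang b v & w = u ++ true :: v]].

Lemma lang2_word a b w : lang2 a b w -> isword (nodes a + nodes b) w.
Proof.
have H t u : lang t u -> size u = (nodes t).*2 /\ count_mem true u = nodes t.
  move=> lu; split; first exact: lang_size.
  elim: lu => //= a' b' u' v c _ IHu _ IHv; rewrite count_cat /= IHu IHv.
  by case: (c) => /=; lia.
move=> [u [v [/H[su cu] /H[sv cv] ->]]].
by rewrite /isword size_cat count_cat /= su sv cu cv; apply/andP; split; apply/eqP; lia.
Qed.

(** The new pair lands on one side of the unmatched letter and enlarges the tree of that side; right
    before that letter counts as the left side. *)
Lemma lang2_ins a b i : i <= (nodes a + nodes b).*2.+1 ->
  exists a' b', nodes a' + nodes b' = (nodes a + nodes b).+1 /\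
    forall w, lang2 a' b' w <-> exists c u, lang2 a b u /\ w = ins i c u.
Proof.
move=> lei; case: (leqP i (nodes a).*2) => lea.
  have [a' sa' la'] := lang_ins lea; exists a', b; split; first by rewrite sa'.
  have E c u v : lang a u -> ins i c (u ++ true :: v) = ins i c u ++ true :: v.
    move=> /lang_size su; rewrite /ins -catA /= take_cat drop_cat su.
    case: ltnP => // ge; have -> : i = (nodes a).*2 by lia.
    by rewrite subnn take0 cats0 drop0 take_oversize ?drop_oversize ?su.
  move=> w; split=> [[x [v [/la'[c [u [lu ->]]] lv ->]]]|[c [x [[u [v [lu lv ->]]] ->]]]].
    by exists c, (u ++ true :: v); rewrite E //; split=> //; exists u, v.
  by rewrite E //; exists (ins i c u), v; split=> //; apply/la'; exists c, u.
have [b' sb' lb'] := @lang_ins b (i - (nodes a).*2.+1) ltac:(lia).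
exists a, b'; split; first by rewrite sb'; lia.
have E c u v : lang a u ->
    ins i c (u ++ true :: v) = u ++ true :: ins (i - (nodes a).*2.+1) c v.
  move=> /lang_size su; rewrite /ins take_cat drop_cat su ltnNge (ltnW lea) /= -catA.
  by have -> : i - (nodes a).*2 = (i - (nodes a).*2.+1).+1 by lia.
move=> w; split=> [[u [x [lu /lb'[c [v [lv ->]]] ->]]]|[c [x [[u [v [lu lv ->]]] ->]]]].
  by exists c, (u ++ true :: v); rewrite E //; split=> //; exists u, v.
by rewrite E //; exists u, (ins (i - (nodes a).*2.+1) c v); split=> //; apply/lb'; exists c, v.
Qed.

Lemma Ccoll_tree q Y : Ccoll q Y ->
  exists a b, nodes a + nodes b = q /\ Y = seq_of @` lang2 a b.
Proof.
elim: q Y => [|q IHq] Y /=.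
  move=> ->; exists Leaf, Leaf; split=> //; apply/seteqP; split=> x.
    move=> [px _ _]; exists [:: true].
      by exists [::], [::]; split; [constructor | constructor |].
    by rewrite (perm_small_eq _ px).
  move=> [w [u [v [lu lv ->]]] <-]; inversion lu; inversion lv.
  by rewrite /Aset.
move=> [i [Y' [lti /IHq[a [b [sab ->]]] ->]]].
have lei : i <= (nodes a + nodes b).*2.+1 by rewrite sab; rewrite doubleS in lti; lia.
have [a' [b' [sab' lab']]] := lang2_ins lei; exists a', b'.
rewrite sab' sab; split=> //.
have E c w : lang2 a b w -> insert_pair i c (seq_of w) = seq_of (ins i c w).
  by move=> /lang2_word ww; apply: (insert_pair_seq_of _ ww).
apply/seteqP; split=> x.
  case=> -[y [w lw <-] <-]; rewrite E //.
    by exists (ins i true w) => //; apply/lab'; exists true, w.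
  by exists (ins i false w) => //; apply/lab'; exists false, w.
move=> [y /lab'[c [w [lw ->]]] <-]; rewrite -E //.
by case: c; [left|right]; exists (seq_of w) => //; exists w.
Qed.

(* f is in fact a bijection onto the nodrop words, but surjectivity is not needed:
   the injectivity of br gives the opposite inequality of cardinals. *)
Lemma Ccoll_canon q : exists f : set (seq nat) -> seq bool,
  (forall Y, Ccoll q Y -> isword q (f Y) /\ nodrop (f Y)) /\
  (forall Y Y', Ccoll q Y -> Ccoll q Y' -> f Y = f Y' -> Y = Y').
Proof.
have /choice[f fP] : forall Y, exists w, Ccoll q Y ->
    exists a b, [/\ nodes a + nodes b = q, Y = seq_of @` lang2 a b & w = canon_word a b].
  move=> Y; case: (pselect (Ccoll q Y)) => [CY|nCY]; last by exists [::].
  by have [a [b [sab eY]]] := Ccoll_tree CY; exists (canon_word a b) => _; exists a, b.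
exists f; split=> [Y /fP[a [b [<- _ ->]]]|Y Y' /fP[a [b [_ -> ->]]] /fP[a' [b' [_ -> ->]]]].
  by split; [apply: isword_canon | apply: nodrop_canon].
by move=> /canon_inj[-> ->].
Qed.

End CollectionWords.

(** * The bijection *)

Section Family.
Local Open Scope classical_set_scope.
Variables (n : nat) (c : set 'CF(WD n)) (br : 'CF(WD n) -> 'CF(WD n)) (L0 : seq nat).
Hypotheses (SL0 : Sym' n L0) (bP : is_bracket c br).
Hypothesis (ec : c = Erep n @` [set L | Sym' n L /\ perm_eq L L0]).

(** The positivity in [is_bracket] cannot hold for the zero character. *)
Lemma Erep_neq0 L : Sym' n L -> c (Erep n L) -> ('[Erep n L, Erep n L] != 0)%R.
Proof.
move=> SL cL; have := bP.2 _ cL; apply: contraPneq => /eqP.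
by rewrite cfnorm_eq0 => /eqP->; rewrite cfdot0r ltxx.
Qed.

Lemma SymcP L : Symc c L <-> Sym' n L /\ perm_eq L L0.
Proof.
split=> [[SL cL]|[SL pL]]; last by split=> //; rewrite ec; exists L.
have := cL; rewrite {1}ec => -[M [SM pM] eM].
suff -> : L = M by [].
by apply: (Erep_orth SL SM); rewrite eM; apply: Erep_neq0.
Qed.

Lemma Erep_inj L L' : Symc c L -> Symc c L' -> Erep n L = Erep n L' -> L = L'.
Proof.
move=> [SL cL] [SL' _] e; apply: (Erep_orth SL SL').
by rewrite -e Erep_neq0.
Qed.

Lemma Symc_finite : finite_set (Symc c).
Proof.
apply: (sub_finite_set (B := [set` permutations L0])); last exact: finite_seq.
by move=> L /SymcP[_ pL] /=; rewrite mem_permutations.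
Qed.

Lemma pnum_perm L : perm_eq L L0 -> pnum L = pnum L0.
Proof.
move=> pL; congr half; apply: perm_size; rewrite /singles.
rewrite (eq_filter (a2 := once L0)) ?perm_filter // => x.
by rewrite /once (seq.permP pL).
Qed.

Lemma pcE : pc c = pnum L0.
Proof.
rewrite /pc; case: xgetP => [k _ [L /SymcP[_ /pnum_perm->]] //|].
by move=> /(_ (pnum L0))[]; exists L0 => //; apply/SymcP.
Qed.

Lemma Symc_word L : Symc c L ->
  exists w, [/\ isword (pc c).-1 w, Lbar L = iota_p (pc c) (seq_of w) &
     size (Sset L) = (pc c).-1 <-> nodrop w].
Proof.
move=> /SymcP[SL pL]; have [w [q [ew ww eq]]] := lword_Sym' SL.
have e1 : pc c = pnum L by rewrite pcE pnum_perm.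
exists w; rewrite e1; have {}ww : isword (pnum L).-1 w by rewrite eq.
by split; [| exact: Lbar_Sym' SL ew ww | exact: Sset_Sym' SL ew ww].
Qed.

Lemma word_Symc w : isword (pc c).-1 w -> exists2 L, Symc c L & Lbar L = iota_p (pc c) (seq_of w).
Proof.
rewrite pcE => ww; have [L [SL pL ew]] := Sym'_of_word SL0 ww.
exists L; first exact/SymcP.
by rewrite -(pnum_perm pL) in ww *; exact: Lbar_Sym' SL ew ww.
Qed.

Lemma iota_p_inj p : injective (iota_p p).
Proof. by move=> b b' /rcons_inj[]. Qed.

(** By pairwise orthogonality the scalar product is zero unless [L] itself indexes a summand. *)
Lemma rep_of_mem Y L : Symc c L -> (0 < '[rep_of c Y, Erep n L])%R ->
  exists2 b, Y b & iota_p (pc c) b = Lbar L.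
Proof.
move=> SL; apply: contraPP => nY.
suff -> : '[rep_of c Y, Erep n L]%R = 0%R by rewrite ltxx.
have fin : finite_set [set L | Symc c L /\ (iota_p (pc c) @` Y) (Lbar L)].
  by apply: sub_finite_set Symc_finite => M [].
rewrite /rep_of fsbig_finite // cfdot_suml big_seq big1 // => M.
rewrite in_fset_set // inE => -[SM [b Yb eb]].
apply/eqP; apply: contraT => nz; case: nY; exists b => //.
by rewrite -(Erep_orth SM.1 SL.1 nz).
Qed.

Lemma Symc_as_Con L : Symc_as c L -> Con c (br (Erep n L)).
Proof.
move=> [SL eS]; have [w [ww ew dw]] := Symc_word SL.
have cL := SL.2; have [/(_ _ cL)[Y BY eY] _ _] := bP.1.
have [b Yb eb] : exists2 b, Y b & iota_p (pc c) b = Lbar L.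
  by apply: rep_of_mem => //; rewrite eY; apply: bP.2.
exists Y => //; apply: (nodrop_Ccoll BY ww); last exact/dw.
by rewrite -(iota_p_inj (etrans eb ew)).
Qed.

Lemma Symc_as_bij : set_bij (Symc_as c) (Con c) (fun L => br (Erep n L)).
Proof.
have inj : set_inj (Symc_as c) (fun L => br (Erep n L)).
  move=> L L'; rewrite !inE => -[SL _] [SL' _] e; apply: Erep_inj => //.
  by have [_ bi _] := bP.1; apply: bi; rewrite ?inE //; [exact: SL.2 | exact: SL'.2].
split=> //; first by move=> L /Symc_as_Con.
have [f [fC fI]] := Ccoll_canon (pc c).-1.
(* [g] sends a constructible character to a symbol whose word is the canonical one of a member of
   [Ccoll] giving that character. *)
have /choice[g gP] : forall K, exists L, Con c K ->
    exists Y, [/\ Ccoll (pc c).-1 Y, rep_of c Y = K, Symc_as c L &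
      Lbar L = iota_p (pc c) (seq_of (f Y))].
  move=> K; case: (pselect (Con c K)) => [[Y CY eK]|nK]; last by exists [::].
  have [wf nf] := fC _ CY; have [L SL eL] := word_Symc wf.
  exists L => _; exists Y; split=> //; split=> //.
  have [w [ww ew dw]] := Symc_word SL; apply/dw.
  by rewrite -(seq_of_inj wf ww (iota_p_inj (etrans (esym eL) ew))).
have gI K K' : Con c K -> Con c K' -> g K = g K' -> K = K'.
  move=> /gP[Y [CY <- _ eY]] /gP[Y' [CY' <- _ eY']] e.
  rewrite e eY' in eY; congr rep_of; apply: fI => //; apply: seq_of_inj (fC _ CY).1 (fC _ CY').1 _.
  by move/iota_p_inj: eY.
(* [h] is an injective map of the finite set [Symc_as c] to itself, hence onto; an [h]-preimage of
   [g K] is then a preimage of [K], as [g] is injective. *)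
pose h L := g (br (Erep n L)).
pose s := [seq L <- permutations L0 | `[< Symc_as c L >]].
have ms L : L \in s <-> Symc_as c L.
  rewrite mem_filter mem_permutations; split=> [/andP[/asboolP]|sL] //.
  by apply/andP; split; [apply/asboolP | have /SymcP[] := sL.1].
have us : uniq (map h s).
  rewrite map_inj_in_uniq ?filter_uniq ?permutations_uniq // => L L' /ms sL /ms sL' e.
  by apply: inj; rewrite ?inE //; apply: gI => //; apply: Symc_as_Con.
have ss : {subset map h s <= s}.
  move=> _ /mapP[L /ms/Symc_as_Con CL ->]; apply/ms.
  by have [Y []] := gP _ CL.
have [_ es] := uniq_min_size us ss (eq_leq (esym (size_map h s))).
move=> K CK; have [Y [_ _ sK _]] := gP _ CK.
have /mapP[L /ms sL eL] : g K \in map h s by rewrite es; apply/ms.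
by exists L => //; apply: gI => //; apply: Symc_as_Con.
Qed.

End Family.

Theorem proposition2p4 (n : nat) (c : set 'CF(WD n))
    (br : 'CF(WD n) -> 'CF(WD n)) :
  2 <= n -> ce' c -> is_bracket c br ->
  set_bij (Symc_as c) (Con c) (fun L => br (Erep n L)) /\
  c_as c br = (Erep n @` Symc_as c)%classic.
Proof.
move=> _ [L0 SL0 ec] bP; have bij := Symc_as_bij SL0 bP ec; split=> //.
have [_ inj surj] := bij; have [_ bi _] := bP.1.
apply/seteqP; split=> [E [cE CE]|_ [L sL <-]].
  (* Here [Erep n L] and [E] have the same bracket, and [br] is injective on [c]. *)
  have [L sL eL] := surj _ CE; exists L => //.
  by apply: bi; rewrite ?inE //; exact: sL.1.2.
by split; [exact: sL.1.2 | apply: (Symc_as_Con SL0 bP ec)].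
Qed.
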